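(* Let $T$ be a bilateral weighted shift acting on $\ell_p(\mathbb{Z})$, $1\le p<\infty$, or on $c_0(\mathbb{Z})$. If $T$ is weakly sequentially hypercyclic, then $T$ is hypercyclic. If $T$ is weakly sequentially supercyclic, then $T$ is supercyclic.
   Context: All spaces are complex. Given a bounded sequence $\{w_n\}_{n\in\mathbb{Z}}$ in $\mathbb{C}\setminus\{0\}$ (the weight sequence), the bilateral weighted shift $T$ on $\ell_p(\mathbb{Z})$, $1\le p<\infty$, or $c_0(\mathbb{Z})$ is the bounded linear operator defined on the canonical basis $\{e_n\}_{n\in\mathbb{Z}}$ by $Te_n=w_ne_{n-1}$. For a bounded linear operator $T$ on a Banach space $\mathcal{B}$ and $x\in\mathcal{B}$ put $O(T,x)=\{T^nx:n=0,1,2,\dots\}$ and $O_{\rm pr}(T,x)=\{\lambda T^nx:n=0,1,2,\dots,\ \lambda\in\mathbb{C}\}$. $T$ is hypercyclic (supercyclic) if $O(T,x)$ (resp. $O_{\rm pr}(T,x)$) is norm dense in $\mathcal{B}$ for some $x$. A subset $A$ of a topological space $X$ is sequentially closed if the limit of every sequence of elements of $A$ converging in $X$ belongs to $A$; the sequential closure $[A]_{\rm s}$ is the intersection of all sequentially closed sets containing $A$; $A$ is sequentially dense if $[A]_{\rm s}=X$. $T$ is weakly sequentially hypercyclic (supercyclic) if for some $x$ the set $O(T,x)$ (resp. $O_{\rm pr}(T,x)$) is sequentially dense in $\mathcal{B}$ with the weak topology. *)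

(* Defs.v *)
From HB Require Import structures.
From mathcomp Require Import all_boot all_order all_algebra.
From mathcomp Require Import finmap complex ring.
From mathcomp Require Import all_classical all_reals all_analysis.

Set Implicit Arguments.
Unset Strict Implicit.
Unset Printing Implicit Defensive.

Import Order.TTheory GRing.Theory Num.Theory.
Import numFieldNormedType.Exports.

Local Open Scope classical_set_scope.
Local Open Scope ring_scope.
Local Open Scope complex_scope.

Section SequentialDensity.
Variable X : topologicalType.
Implicit Types A : set X.

Definition seq_closed A :=
  forall (u : nat -> X) (x : X),
    (forall n, A (u n)) -> u n @[n --> \oo] --> x -> A x.

Definition seq_closure A : set X := smallest seq_closed A.

Definition seq_dense A := seq_closure A = setT.

End SequentialDensity.

Section WeakTopology.
Variables (K : numFieldType) (V : normedModType K).

Definition topological_dual := {f : {linear V -> K^o} | continuous f}.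

(* the coarsest topology on [V] making every element of the dual continuous *)
Definition weak_space := sup_topology (fun f : topological_dual =>
  Topological.class (initial_topology (sval f : V -> K^o))).

HB.instance Definition _ := Topological.on weak_space.

End WeakTopology.

Section Dynamics.
Variables (K : numFieldType) (V : normedModType K).
Implicit Types (T : V -> V) (x : V).

Definition orbit_of T x : set V := [set iter n T x | n in [set: nat]].

Definition projective_orbit T x : set V :=
  [set y | exists (a : K) (n : nat), y = a *: iter n T x].

Definition hypercyclic T := exists x, dense (orbit_of T x).

Definition supercyclic T := exists x, dense (projective_orbit T x).

Definition weakly_seq_hypercyclic T :=
  exists x, seq_dense (orbit_of T x : set (weak_space V)).

Definition weakly_seq_supercyclic T :=
  exists x, seq_dense (projective_orbit T x : set (weak_space V)).

(* [T] is determined by [w], since in the spaces below the span of the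
   canonical basis [e] is dense. *)
Definition bilateral_weighted_shift
    (e : int -> V) (w : int -> K) (T : {linear V -> V}) :=
  [/\ (forall n, w n != 0), (exists M : K, forall n, `|w n| <= M),
      (exists M : K, forall x, `|T x| <= M * `|x|)
    & forall n, T (e n) = w n *: e (n - 1)].

End Dynamics.


Section Modulus.
Variable R : realType.
Implicit Types a b : R[i].

(* The norm [`|a|] of [R[i]] takes its values in [R[i]]; this is the same
   modulus as an element of [R]. *)
Definition modulus a : R := ComplexField.Normc.normc a.

Lemma modulusE a : `|a| = (modulus a)%:C. Proof. by case: a. Qed.

Lemma modulus_ge0 a : 0 <= modulus a.
Proof. by rewrite -lecR -modulusE normr_ge0. Qed.

Lemma modulus0 : modulus 0 = 0.
Proof. exact: ComplexField.Normc.normc0. Qed.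

Lemma modulus1 : modulus 1 = 1.
Proof. exact: ComplexField.Normc.normc1. Qed.

Lemma modulus_eq0 a : modulus a = 0 -> a = 0.
Proof. by move=> a0; apply/normr0_eq0; rewrite modulusE a0. Qed.

Lemma modulusM a b : modulus (a * b) = modulus a * modulus b.
Proof. exact: ComplexField.Normc.normcM. Qed.

Lemma ler_modulusD a b : modulus (a + b) <= modulus a + modulus b.
Proof. exact: le_normcD. Qed.

End Modulus.

Definition seq_delta (R : realType) (n : int) : int -> R[i] :=
  fun m => (m == n)%:R.

Section PowerSum.
Variables (R : realType) (p : R).
Hypothesis p1 : 1 <= p.
Implicit Types x y : int -> R[i].

Let p0 : 0 < p. Proof. exact: lt_le_trans p1. Qed.

Definition psum x : \bar R := \esum_(n in [set: int]) (modulus (x n) `^ p)%:E.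

Definition pnorm x : R := fine (psum x) `^ p^-1.

Lemma psum_ge0 x : (0 <= psum x)%E.
Proof. by apply: esum_ge0 => n _; rewrite lee_fin powR_ge0. Qed.

Lemma pnorm_ge0 x : 0 <= pnorm x. Proof. exact: powR_ge0. Qed.

Lemma psumE x : (psum x < +oo)%E -> psum x = (pnorm x `^ p)%:E.
Proof.
move=> fx; rewrite /pnorm -powRrM mulVf ?gt_eqF// powRr1 ?fineK//.
  by rewrite ge0_fin_numE ?psum_ge0.
exact/fine_ge0/psum_ge0.
Qed.

Lemma pnorm_le x (M : R) : 0 <= M -> (psum x <= (M `^ p)%:E)%E -> pnorm x <= M.
Proof.
move=> M0 xM; have fx : (psum x < +oo)%E by exact: le_lt_trans xM (ltry _).
move: xM; rewrite psumE// lee_fin => xM; rewrite leNgt; apply/negP => Mx.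
have := gt0_ltr_powR p0 M0 (pnorm_ge0 x) Mx.
by rewrite ltNge xM.
Qed.

Lemma le_psumP x (M : R) :
  (forall F : {fset int}, \sum_(n <- F) modulus (x n) `^ p <= M) <->
  (psum x <= M%:E)%E.
Proof.
split=> [xM|xM F].
  apply: ge_ereal_sup => _ [A [finA _] <-].
  by rewrite fsbig_finite//= sumEFin lee_fin.
rewrite -lee_fin -sumEFin; apply: le_trans xM; apply: esum_ge.
exists [set` F]; first by split.
by rewrite fsbig_finite//= set_fsetK.
Qed.

Lemma psumD_pos x y (a b : R) : 0 < a -> 0 < b ->
  (psum x <= (a `^ p)%:E)%E -> (psum y <= (b `^ p)%:E)%E ->
  (psum (x + y)%R <= ((a + b) `^ p)%:E)%E.
Proof.
move=> a0 b0 /le_psumP xa /le_psumP yb; apply/le_psumP => F.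
have ab0 : 0 < a + b by exact: addr_gt0.
have [a0w b0w ab0w p0w] := And4 (ltW a0) (ltW b0) (ltW ab0) (ltW p0).
have t0 : 0 <= a / (a + b) by exact: divr_ge0.
have t1 : a / (a + b) <= 1 by rewrite ler_pdivrMr// mul1r lerDl.
have tb : 1 - a / (a + b) = b / (a + b) by field; rewrite gt_eqF.
have powRdiv (u c : R) : 0 <= u -> 0 <= c -> (u / c) `^ p = u `^ p / c `^ p.
  by move=> u0 c0; rewrite powRM ?invr_ge0// -powR_inv1// powRAC powR_inv1 ?powR_ge0.
have key n : modulus ((x + y) n) `^ p <= (a + b) `^ p *
    (a / (a + b) * (modulus (x n) `^ p / a `^ p) +
     b / (a + b) * (modulus (y n) `^ p / b `^ p)).
  have [x0 y0] : 0 <= modulus (x n) /\ 0 <= modulus (y n).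
    by rewrite !modulus_ge0.
  apply: (@le_trans _ _ ((modulus (x n) + modulus (y n)) `^ p)).
    by apply: ge0_ler_powR; rewrite ?nnegrE ?addr_ge0 ?modulus_ge0 ?ler_modulusD.
  have -> : modulus (x n) + modulus (y n) = (a + b) *
      (a / (a + b) * (modulus (x n) / a) + b / (a + b) * (modulus (y n) / b)).
    by field; rewrite !gt_eqF.
  have := @convex_powR _ _ p1 (Itv01 t0 t1)
    (modulus (x n) / a) (modulus (y n) / b).
  rewrite !inE/= !in_itv/= !andbT !divr_ge0// => /(_ isT isT) cv.
  have {}cv : (a / (a + b) * (modulus (x n) / a) +
      (1 - a / (a + b)) * (modulus (y n) / b)) `^ p <=
      a / (a + b) * (modulus (x n) / a) `^ p +
      (1 - a / (a + b)) * (modulus (y n) / b) `^ p by exact: cv.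
  rewrite tb !powRdiv// in cv.
  have le_t : 0 <= a / (a + b) * (modulus (x n) / a) +
      b / (a + b) * (modulus (y n) / b).
    by rewrite addr_ge0// mulr_ge0// divr_ge0.
  by rewrite powRM// ler_wpM2l ?powR_ge0.
apply: (le_trans (ler_sum _ (fun n _ => key n))).
rewrite -mulr_sumr big_split/= -!mulr_sumr -!mulr_suml.
rewrite -[leRHS]mulr1 ler_wpM2l ?powR_ge0//.
apply: (@le_trans _ _ (a / (a + b) * 1 + b / (a + b) * 1)).
  by apply: lerD; rewrite ler_wpM2l ?divr_ge0// ler_pdivrMr ?powR_gt0// mul1r.
by rewrite !mulr1 -mulrDl divff// gt_eqF.
Qed.

Lemma psumD x y : (psum x < +oo)%E -> (psum y < +oo)%E ->
  (psum (x + y)%R < +oo)%E /\ pnorm (x + y) <= pnorm x + pnorm y.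
Proof.
move=> fx fy.
have aux e : 0 < e ->
    (psum (x + y)%R <= ((pnorm x + pnorm y + e) `^ p)%:E)%E.
  move=> e0; rewrite [e]splitr addrACA.
  have le_e z : (psum z < +oo)%E -> (psum z <= ((pnorm z + e / 2) `^ p)%:E)%E.
    move=> fz; rewrite psumE// lee_fin ge0_ler_powR ?nnegrE ?pnorm_ge0 ?(ltW p0)//.
      by rewrite addr_ge0 ?pnorm_ge0// divr_ge0// ltW.
    by rewrite lerDl divr_ge0// ltW.
  by apply: psumD_pos; rewrite ?ltr_wpDl ?pnorm_ge0 ?divr_gt0 ?le_e.
split; first exact: le_lt_trans (aux 1 _) (ltry _).
apply/ler_addgt0Pr => e e0; apply: pnorm_le (aux _ e0).
by rewrite !addr_ge0 ?pnorm_ge0// ltW.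
Qed.

Lemma psumZ (a : R[i]) x : (psum x < +oo)%E ->
  (psum (a *: x)%R < +oo)%E /\ pnorm (a *: x) <= modulus a * pnorm x.
Proof.
move=> fx.
have aux : (psum (a *: x)%R <= ((modulus a * pnorm x) `^ p)%:E)%E.
  apply/le_psumP => F; rewrite powRM ?modulus_ge0 ?pnorm_ge0//.
  under eq_bigr do rewrite [(_ *: _) _]/(a * _) modulusM powRM ?modulus_ge0//.
  rewrite -mulr_sumr ler_wpM2l ?powR_ge0//; move: F; apply/le_psumP.
  by rewrite psumE.
split; first exact: le_lt_trans aux (ltry _).
by apply: pnorm_le aux; rewrite mulr_ge0 ?modulus_ge0 ?pnorm_ge0.
Qed.

Lemma modulus_le_pnorm x n : (psum x < +oo)%E -> modulus (x n) <= pnorm x.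
Proof.
move=> fx; rewrite leNgt; apply/negP => xn.
have := gt0_ltr_powR p0 (pnorm_ge0 x) (modulus_ge0 (x n)) xn.
rewrite ltNge => /negP; apply.
have /le_psumP/(_ [fset n]%fset) : (psum x <= (pnorm x `^ p)%:E)%E by rewrite psumE.
by rewrite big_seq_fset1.
Qed.

Lemma psum0 : psum 0 = 0%E.
Proof. by apply: esum1 => n _; rewrite modulus0 powR0 ?gt_eqF. Qed.

Lemma psum_delta n : (psum (seq_delta R n) < +oo)%E.
Proof.
have -> : psum (seq_delta R n) = \esum_(m in [set n]) 1%E; last first.
  by rewrite esum_set1 ?lee01// ltry.
rewrite [RHS]esum_mkcond; apply: eq_esum => m _; rewrite in_set1 /seq_delta.
by case: eqVneq => _; rewrite ?modulus0 ?powR0 ?gt_eqF// modulus1 powR1.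
Qed.

End PowerSum.

Section Ellp.
Variables (R : realType) (p : R) (p1 : 1 <= p).

(* [p1] is an argument so that the closure property below, which needs it, can
   be inferred from the predicate. *)
Definition p_summable of 1 <= p : {pred int -> R[i]} :=
  fun x => `[< (psum p x < +oo)%E >].

Lemma p_summableP x : reflect (psum p x < +oo)%E (x \in p_summable p1).
Proof. exact: asboolP. Qed.

Lemma p_summable_submod_closed : submod_closed (p_summable p1).
Proof.
split=> [|a x y /p_summableP fx /p_summableP fy]; apply/p_summableP.
  by rewrite psum0// ltry.
exact: (psumD p1 (psumZ p1 a fx).1 fy).1.
Qed.

HB.instance Definition _ := GRing.isSubmodClosed.Build _ _ (p_summable p1)
  p_summable_submod_closed.

Record ellp := Ellp {
  ellp_val :> int -> R[i];
  ellpP : ellp_val \in p_summable p1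
}.

HB.instance Definition _ := [isSub for ellp_val].
HB.instance Definition _ := [Choice of ellp by <:].
HB.instance Definition _ := [SubChoice_isSubLmodule of ellp by <:].

Definition ellp_norm (x : ellp) : R[i] := (pnorm p x)%:C.

Let ellp_ler_normD (x y : ellp) :
  ellp_norm (x + y) <= ellp_norm x + ellp_norm y.
Proof.
rewrite /ellp_norm -rmorphD lecR.
exact: (psumD p1 (p_summableP _ (ellpP x)) (p_summableP _ (ellpP y))).2.
Qed.

Let ellp_normZ_le (a : R[i]) (x : ellp) : ellp_norm (a *: x) <= `|a| * ellp_norm x.
Proof.
rewrite modulusE -rmorphM lecR.
exact: (psumZ p1 a (p_summableP _ (ellpP x))).2.
Qed.

Let ellp_normr0_eq0 (x : ellp) : ellp_norm x = 0 -> x = 0.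
Proof.
move=> /(congr1 (@complex.Re R))/= x0; apply/val_inj/funext => n /=.
apply: modulus_eq0; apply/le_anti; rewrite modulus_ge0 andbT -x0.
exact/modulus_le_pnorm/p_summableP/ellpP.
Qed.

Let ellp_normrZ (a : R[i]) (x : ellp) : ellp_norm (a *: x) = `|a| * ellp_norm x.
Proof.
have [->|a0] := eqVneq a 0.
  apply/le_anti; rewrite ellp_normZ_le normr0 mul0r /ellp_norm.
  by rewrite lecR pnorm_ge0.
apply/le_anti; rewrite ellp_normZ_le/=.
rewrite -ler_pdivlMl ?normr_gt0// -normfV.
by have := ellp_normZ_le a^-1 (a *: x); rewrite scalerA (mulVf a0) scale1r.
Qed.

HB.instance Definition _ := Lmodule_isNormed.Build R[i] ellp
  ellp_ler_normD ellp_normrZ ellp_normr0_eq0.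

Lemma ellp_delta_subproof n : seq_delta R n \in p_summable p1.
Proof. by apply/p_summableP; exact: psum_delta. Qed.

Definition ellp_delta n : ellp := Ellp (ellp_delta_subproof n).

End Ellp.

Section SupNorm.
Variable R : realType.
Implicit Types x y : int -> R[i].

(* [x n] tends to 0 as [|n|] tends to infinity *)
Definition vanishing : {pred int -> R[i]} := fun x =>
  `[< forall e : R, 0 < e ->
      exists N : nat, forall n : int, (N <= `|n|)%N -> modulus (x n) < e >].

Definition supnorm x : R := sup [set modulus (x n) | n in [set: int]].

Lemma vanishing_submod_closed : submod_closed vanishing.
Proof.
split=> [|a x y /asboolP vx /asboolP vy]; apply/asboolP => e e0.
  by exists 0%N => n _; rewrite modulus0.
have a1 : 0 < modulus a + 1 by rewrite ltr_wpDl ?modulus_ge0.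
have [N1 xN] := vx (e / 2 / (modulus a + 1)) (divr_gt0 (divr_gt0 e0 (ltr0Sn R 1)) a1).
have [N2 yN] := vy (e / 2) (divr_gt0 e0 (ltr0Sn R 1)).
exists (maxn N1 N2) => n; rewrite geq_max => /andP[/xN xn /yN yn].
apply: le_lt_trans (ler_modulusD _ _) _; rewrite [e]splitr ler_ltD//.
rewrite [(_ *: _) _]/(a * _) modulusM.
apply: (@le_trans _ _ ((modulus a + 1) * modulus (x n))).
  by rewrite ler_wpM2r ?modulus_ge0// lerDl.
by rewrite mulrC -ler_pdivlMr// ltW.
Qed.

HB.instance Definition _ := GRing.isSubmodClosed.Build _ _ vanishing
  vanishing_submod_closed.

Lemma vanishing_has_sup x : x \in vanishing ->
  has_sup [set modulus (x n) | n in [set: int]].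
Proof.
move=> /asboolP/(_ 1 ltr01)[N xN]; split; first by exists (modulus (x 0)), 0.
pose M := \sum_(i < N) (modulus (x i%:Z) + modulus (x (- i%:Z))).
have sum_ge0 (P : pred 'I_N) :
    0 <= \sum_(i < N | P i) (modulus (x i%:Z) + modulus (x (- i%:Z))).
  by apply: sumr_ge0 => i _; rewrite addr_ge0 ?modulus_ge0.
exists (1 + M) => _ [n _ <-]; have [nN|nN] := leqP N `|n|.
  by rewrite (le_trans (ltW (xN _ nN)))// lerDl sum_ge0.
rewrite ler_wpDl// /M (bigD1 (Ordinal nN))//= ler_wpDr ?sum_ge0//.
by case: (intP n) => [|k|k]/=; rewrite ?lerDl ?lerDr ?modulus_ge0.
Qed.

Lemma modulus_le_supnorm x n : x \in vanishing -> modulus (x n) <= supnorm x.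
Proof. by move=> /vanishing_has_sup/sup_upper_bound; apply; exists n. Qed.

Lemma supnorm_le x (M : R) : (forall n, modulus (x n) <= M) -> supnorm x <= M.
Proof.
move=> xM; apply: ge_sup; first by exists (modulus (x 0)), 0.
by move=> _ [n _ <-].
Qed.

End SupNorm.

Section C0.
Variable R : realType.

Record c0 := C0 {
  c0_val :> int -> R[i];
  c0P : c0_val \in @vanishing R
}.

HB.instance Definition _ := [isSub for c0_val].
HB.instance Definition _ := [Choice of c0 by <:].
HB.instance Definition _ := [SubChoice_isSubLmodule of c0 by <:].

Definition c0_norm (x : c0) : R[i] := (supnorm x)%:C.

Let c0_ler_normD (x y : c0) : c0_norm (x + y) <= c0_norm x + c0_norm y.
Proof.
rewrite /c0_norm -rmorphD lecR; apply: supnorm_le => n.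
apply: le_trans (ler_modulusD _ _) _.
by rewrite lerD// modulus_le_supnorm ?c0P.
Qed.

Let c0_normrZ (a : R[i]) (x : c0) : c0_norm (a *: x) = `|a| * c0_norm x.
Proof.
have normZ_le (b : R[i]) (y : c0) : c0_norm (b *: y) <= `|b| * c0_norm y.
  rewrite modulusE -rmorphM lecR; apply: supnorm_le => n.
  by rewrite [(c0_val _) _]/(b * _) modulusM ler_wpM2l ?modulus_ge0
    ?modulus_le_supnorm ?c0P.
have [->|a0] := eqVneq a 0.
  apply/le_anti; rewrite normZ_le normr0 mul0r /c0_norm lecR.
  exact: le_trans (modulus_ge0 _) (modulus_le_supnorm 0 (c0P _)).
apply/le_anti; rewrite normZ_le/= -ler_pdivlMl ?normr_gt0// -normfV.
by have := normZ_le a^-1 (a *: x); rewrite scalerA (mulVf a0) scale1r.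
Qed.

Let c0_normr0_eq0 (x : c0) : c0_norm x = 0 -> x = 0.
Proof.
move=> /(congr1 (@complex.Re R))/= x0; apply/val_inj/funext => n /=.
apply: modulus_eq0; apply/le_anti; rewrite modulus_ge0 andbT -x0.
exact/modulus_le_supnorm/c0P.
Qed.

HB.instance Definition _ := Lmodule_isNormed.Build R[i] c0
  c0_ler_normD c0_normrZ c0_normr0_eq0.

Lemma c0_delta_subproof n : seq_delta R n \in @vanishing R.
Proof.
apply/asboolP => e e0; exists `|n|.+1 => m; rewrite /seq_delta.
by case: eqVneq => [->|_]; rewrite ?ltnn// modulus0.
Qed.

Definition c0_delta n : c0 := C0 (c0_delta_subproof n).

End C0.

(* Main.v *)
From HB Require Import structures.
Require Import Defs.
From mathcomp Require Import finmap.
From mathcomp Require Import all_boot all_order all_algebra.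
From mathcomp Require Import complex ring lra zify.
From mathcomp Require Import all_classical all_reals all_analysis.

Set Implicit Arguments.
Unset Strict Implicit.
Unset Printing Implicit Defensive.

Import Order.TTheory GRing.Theory Num.Theory.
Import numFieldNormedType.Exports.

Local Open Scope classical_set_scope.
Local Open Scope ring_scope.
Local Open Scope complex_scope.

(** Iterating the shift gives [T^n e_j = W n j *: e_(j - n)], where
[W n j = w j * w (j - 1) * ... * w (j - n + 1)]. Whether the scaled iterates
[a *: T^n x] of some vector [x] are dense depends only on the weights: for
every finite window of indices one needs arbitrarily large [n] and a scalar [a]
such that [a * W n j] is small, so that vectors supported in the window are
forgotten, and [a * W n (j + n)] is large, so that such vectors are images of
small ones, for all [j] in the window. This is Salas' condition; the allowed
scalars [a] form a set [L], which is [{1}] for hypercyclicity and the set of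
nonzero scalars for supercyclicity. Both halves of the theorem are the same two
implications for these two choices of [L].

Weak sequential density implies the condition ([weak_orbit_salas]). Suppose
that [a_k *: T^(n_k) x] tends weakly to [y], with [n_k] tending to infinity and
no entry of [y] in the window equal to 0. Up to a shift of [n_k] and a change
of [a_k], the vector [x] may be replaced by another vector [u] of the orbit,
whose entries in the window are as large as desired ([orbit_large_window]). A
weakly convergent sequence is bounded ([uniform_boundedness]), so the entry
[a_k * W n_k j * u_j] at [j - n_k] is bounded by a constant independent of [u];
as [u_j] is huge, [a_k * W n_k j] is small. The entry
[a_k * W n_k (j + n_k) * u_(j + n_k)] at [j] stays away from 0 whereas
[u_(j + n_k)] tends to 0, so [a_k * W n_k (j + n_k)] is large. Boundedness is
what sequences give and nets do not.

Such a limit exists ([orbit_weak_limit]): otherwise the orbit together with the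
vectors having a zero entry in the window would be weakly sequentially closed,
hence be the whole space. Then a sequence of vectors without zeros in the
window, converging in norm to such a vector and lying on pairwise distinct
lines, would consist of vectors [a_k *: T^(n_k) x] with distinct [n_k], and so
be of the excluded kind.

The condition implies a norm dense orbit ([salas_dense_orbit]) by the
construction of the hypercyclicity criterion: [x] is a sum of tiny finitely
supported vectors, the [k]-th of which is sent by [a_k *: T^(n_k)] onto the
[k]-th element of a dense sequence, while [n_k] and the later terms are chosen
so that all other terms of the sum contribute little at that time. *)

(** * Moduli, norms and weak convergence *)

Section RealNorm.
Variables (R : realType) (V : normedModType R[i]).
Implicit Types (x y : V) (a b : R[i]).

Lemma modulus_real (r : R) : modulus r%:C = `|r|.
Proof. by rewrite /modulus /= expr0n /= addr0 sqrtr_sqr. Qed.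

Lemma modulusN a : modulus (- a) = modulus a.
Proof. by have := normrN a; rewrite !modulusE => /complexI. Qed.

Lemma modulusB a b : modulus (a - b) = modulus (b - a).
Proof. by rewrite -modulusN opprB. Qed.

Lemma modulusV a : modulus a^-1 = (modulus a)^-1.
Proof. exact: ComplexField.Normc.normcV. Qed.

Lemma modulus_gt0 a : (0 < modulus a) = (a != 0).
Proof.
rewrite lt_neqAle modulus_ge0 andbT eq_sym; congr negb.
by apply/eqP/eqP => [/modulus_eq0//|->]; rewrite modulus0.
Qed.

Lemma le_modulus_sub a b : modulus a <= modulus b + modulus (a - b).
Proof. by rewrite -[X in modulus X <= _](subrKC b) ler_modulusD. Qed.

(** The norm of a module over [R[i]] takes its values in [R[i]]; estimates are
made with the same norm as an element of [R]. *)
Definition rnorm x : R := complex.Re `|x|.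

Lemma rnormE x : `|x| = (rnorm x)%:C.
Proof. by rewrite /rnorm RRe_real// normr_real. Qed.

Lemma rnorm_ge0 x : 0 <= rnorm x.
Proof. by rewrite -lecR -rnormE normr_ge0. Qed.

Lemma rnorm0 : rnorm 0 = 0.
Proof. by rewrite /rnorm normr0. Qed.

Lemma rnormD x y : rnorm (x + y) <= rnorm x + rnorm y.
Proof. by rewrite -lecR rmorphD /= -!rnormE ler_normD. Qed.

Lemma rnormB x y : rnorm (x - y) = rnorm (y - x).
Proof. by rewrite /rnorm distrC. Qed.

Lemma rnormZ a x : rnorm (a *: x) = modulus a * rnorm x.
Proof.
by apply: complexI; rewrite rmorphM/= -rnormE normrZ modulusE rnormE.
Qed.

End RealNorm.

Lemma modulus_harmonic (R : realType) (n : nat) :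
  modulus (n.+1%:R^-1 : R[i]) = n.+1%:R^-1.
Proof.
by rewrite modulusV -(rmorph_nat (real_complex R)) modulus_real ger0_norm.
Qed.

Lemma harmonic_lt (R : realType) (d : R) : 0 < d ->
  exists N, forall n, (N <= n)%N -> n.+1%:R^-1 < d.
Proof.
move=> d0; exists (Num.bound d^-1) => n nb; rewrite invf_plt ?posrE//.
have /lt_le_trans := archi_boundP (ltW (elimT idP (etrans (invr_gt0 _) d0))).
by apply; rewrite ler_nat leqW.
Qed.

(** Stated over an arbitrary field of scalars because the weak topology is
built from the topology that [K^o] has there. *)
Lemma weak_cvgP (K : numFieldType) (V : normedModType K)
    (v : nat -> V) (y : V) :
  (v n : weak_space V) @[n --> \oo] --> (y : weak_space V) <->
  forall g : topological_dual V,
    (sval g (v n) : K^o) @[n --> \oo] --> (sval g y : K^o).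
Proof.
split=> [vy g|vy].
  have vg := (cvg_sup _ _ _).1 vy g.
  move=> A Ay; have gy := @initial_continuous V K^o (sval g) y _ Ay.
  exact: vg gy.
apply/cvg_sup => g A [B [[C Co <-] By] BA].
have /vy : nbhs (sval g y : K^o) C by exact: open_nbhs_nbhs.
by move=> [N _ h]; exists N => // n /h Cn; apply: BA; exact: Cn.
Qed.

Section WeakConvergence.
Variables (R : realType) (V : normedModType R[i]).

(** Functionals as bare functions: those constructed below are pointwise
limits, for which linearity is a theorem. *)
Definition bounded_functional (f : V -> R[i]) :=
  (forall a x y, f (a *: x + y) = a * f x + f y) /\
  exists K : R, forall x, modulus (f x) <= K * rnorm x.

Lemma bounded_functional_continuous (f : {linear V -> R[i]^o}) (K : R) :
  (forall x, modulus (f x) <= K * rnorm x) -> continuous f.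
Proof.
move=> fK; apply: bounded_linear_continuous.
have K0 : 0 <= `|K| + 1 :> R by rewrite addr_ge0.
exists (`|K| + 1)%:C; split; first by rewrite realE ler0c K0.
move=> M KM; apply/nbhs_ballP; exists 1 => //= x.
rewrite -ball_normE /= sub0r normrN => x1.
rewrite (le_trans _ (ltW KM))//.
have -> : `|f x| = (modulus (f x))%:C by exact: modulusE.
rewrite lecR (le_trans (fK x))//.
have {}x1 : rnorm x < 1 by rewrite -ltcR -rnormE.
rewrite (le_trans (ler_norm _))// normrM (ger0_norm (rnorm_ge0 _)).
by have := normr_ge0 K; have := rnorm_ge0 x; nra.
Qed.

Lemma weak_cvg_functional (v : nat -> V) (y : V) (f : V -> R[i]) :
  bounded_functional f ->
  (v n : weak_space V) @[n --> \oo] --> (y : weak_space V) ->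
  forall d : R, 0 < d ->
    exists N, forall n, (N <= n)%N -> modulus (f (v n) - f y) < d.
Proof.
move=> [flin [K fK]] vy d d0.
have L : linear (f : V -> R[i]^o) by exact: flin.
pose g : {linear V -> R[i]^o} := HB.pack (f : V -> R[i]^o)
  (@GRing.isLinear.Build R[i] V R[i]^o *:%R (f : V -> R[i]^o) L).
have gc : continuous g := @bounded_functional_continuous g K fK.
have /cvgrPdist_lt/(_ d%:C) := (weak_cvgP v y).1 vy (exist _ g gc).
rewrite ltcR d0 => /(_ isT)[N _ Nb]; exists N => n /Nb /= he.
by rewrite modulusB -ltcR -modulusE; exact: he.
Qed.

Lemma norm_cvg_weak (v : nat -> V) (y : V) :
  (forall d : R, 0 < d ->
     exists N, forall n, (N <= n)%N -> rnorm (v n - y) < d) ->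
  (v n : weak_space V) @[n --> \oo] --> (y : weak_space V).
Proof.
move=> vy; have {}vy : v n @[n --> \oo] --> y.
  apply/cvgrPdist_lt => e e0.
  have ->: e = (complex.Re e)%:C by rewrite RRe_real// gtr0_real.
  have [|N vN] := vy (complex.Re e); first by move: e0; rewrite ltcE => /andP[].
  by exists N => // n /vN; rewrite rnormE ltcR rnormB.
by apply/weak_cvgP => -[g gc] /=; apply: cvg_comp vy _; exact: gc.
Qed.

End WeakConvergence.

(** * Uniform boundedness by a gliding hump *)

Section GlidingHump.
Variables (R : realType).

(** The bounds [g i - 2 * B / 16 ^ i] increase and the bounds
[g i + 2 * B / 16 ^ i] decrease; the limit is the supremum of the former. *)
Lemma geometric_real_limit (g : nat -> R) (B : R) :
  (forall i, `|g i.+1 - g i| <= B * 16^-1 ^+ i) ->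
  exists l, forall i, `|l - g i| <= 2 * B * 16^-1 ^+ i.
Proof.
move=> gB; pose lo i := g i - 2 * B * 16^-1 ^+ i.
pose up i := g i + 2 * B * 16^-1 ^+ i.
have B0 i : 0 <= B * 16^-1 ^+ i by exact: le_trans (gB i).
have loS i : lo i <= lo i.+1.
  have := gB i; rewrite /lo exprS ler_norml => /andP[h1 _].
  have := B0 i; lra.
have upS i : up i.+1 <= up i.
  have := gB i; rewrite /up exprS ler_norml => /andP[_ h1].
  have := B0 i; lra.
have loM := @homo_leq _ lo <=%O (@lexx _ _) (@le_trans _ _) loS.
have upM := @homo_leq _ up (fun a b => b <= a) (@lexx _ _)
  (fun y x z h1 h2 => le_trans h2 h1) upS.
have loup i j : lo i <= up j.
  apply: (@le_trans _ _ (lo (maxn i j))); first exact/loM/leq_maxl.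
  apply: (@le_trans _ _ (up (maxn i j))); last exact/upM/leq_maxr.
  by rewrite /lo /up; have := B0 (maxn i j); lra.
have hs : has_sup (range lo).
  by split; [exists (lo 0), 0%N | exists (up 0%N) => _ [i _ <-]].
exists (sup (range lo)) => i; rewrite ler_norml; apply/andP; split.
  have : lo i <= sup (range lo) by apply: sup_upper_bound => //; exists i.
  by rewrite /lo; lra.
have : sup (range lo) <= up i.
  by apply: ge_sup; [exists (lo 0), 0%N | move=> _ [j _ <-]].
by rewrite /up; lra.
Qed.

Lemma modulus_ReIm (a : R[i]) :
  [/\ `|complex.Re a| <= modulus a, `|complex.Im a| <= modulus a &
      modulus a <= `|complex.Re a| + `|complex.Im a|].
Proof.
split.
- by have := normc_ge_Re a; rewrite modulusE lecR.
- by have := normc_ge_Re (a * 'i); rewrite modulusE lecR ReiNIm normrN modulusM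
    [modulus 'i]/= expr0n expr1n add0r sqrtr1 mulr1.
rewrite {1}(complexE a) (le_trans (ler_modulusD _ _))// modulusM !modulus_real.
by rewrite [modulus 'i]/= expr0n expr1n add0r sqrtr1 mul1r.
Qed.

Lemma geometric_limit (g : nat -> R[i]) (B : R) :
  (forall i, modulus (g i.+1 - g i) <= B * 16^-1 ^+ i) ->
  exists l, forall i, modulus (l - g i) <= 4 * B * 16^-1 ^+ i.
Proof.
move=> gB.
have [|r rP] := @geometric_real_limit (fun i => complex.Re (g i)) B.
  move=> i; rewrite -raddfB; apply: le_trans (gB i).
  by case: (modulus_ReIm (g i.+1 - g i)).
have [|s sP] := @geometric_real_limit (fun i => complex.Im (g i)) B.
  move=> i; rewrite -raddfB; apply: le_trans (gB i).
  by case: (modulus_ReIm (g i.+1 - g i)).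
exists (r +i* s) => i.
case: (modulus_ReIm ((r +i* s) - g i)) => _ _ /le_trans; apply.
rewrite !raddfB /=; have := rP i; have := sP i; lra.
Qed.

Lemma invX_small (e C : R) : 0 < e -> exists i, C * 16^-1 ^+ i < e.
Proof.
move=> e0; have [N hN] : exists N : nat, `|C| / e < N%:R.
  by exists (Num.bound (`|C| / e)); rewrite archi_boundP// divr_ge0// ltW.
exists N; apply: le_lt_trans (_ : `|C| * 16^-1 ^+ N < _).
  by rewrite ler_wpM2r ?exprn_ge0 ?invr_ge0 ?ler_norm.
rewrite exprVn -ltr_pdivlMr ?invr_gt0 ?exprn_gt0// invrK mulrC -ltr_pdivrMr//.
apply: lt_le_trans hN _.
by rewrite -natrX ler_nat ltnW// ltn_expl.
Qed.

Variables (V : normedModType R[i]).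

(** The second conclusion keeps the bound [B] separate from the norm of [x]: it
is applied with a bound on the values at [x] of the functionals being summed,
which can be far below the norm. *)
Lemma geometric_functional_limit (g : nat -> V -> R[i]) :
  (forall i a x y, g i (a *: x + y) = a * g i x + g i y) ->
  (forall x, g 0%N x = 0) ->
  (forall i x, modulus (g i.+1 x - g i x) <= rnorm x * 16^-1 ^+ i) ->
  exists f, bounded_functional f /\
    forall x B, (forall i, modulus (g i.+1 x - g i x) <= B * 16^-1 ^+ i) ->
      forall i, modulus (f x - g i x) <= 4 * B * 16^-1 ^+ i.
Proof.
move=> glin g0 gs.
have /choice[f fP] : forall x, exists l, forall i,
    modulus (l - g i x) <= 4 * rnorm x * 16^-1 ^+ i.
  by move=> x; apply: geometric_limit => i; exact: gs.
have uniq (h : nat -> R[i]) l l' C C' :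
  (forall i, modulus (l - h i) <= C * 16^-1 ^+ i) ->
  (forall i, modulus (l' - h i) <= C' * 16^-1 ^+ i) -> l = l'.
  move=> lh lh'; apply/eqP; rewrite -subr_eq0 -[_ == 0]negbK -modulus_gt0.
  apply/negP => ll'; have [i hi] := invX_small (C + C') ll'; move: hi.
  apply/negP; rewrite -leNgt mulrDl.
  rewrite (_ : l - l' = (l - h i) + (h i - l')); last by ring.
  by rewrite (le_trans (ler_modulusD _ _))// lerD// modulusB.
exists f; split; [split|].
- move=> a x y; pose h i := g i (a *: x + y).
  apply: (uniq h _ _ (4 * rnorm (a *: x + y))
      (modulus a * (4 * rnorm x) + 4 * rnorm y)).
    by move=> i; exact: fP.
  move=> i; rewrite /h glin.
  have -> : a * f x + f y - (a * g i x + g i y) =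
    a * (f x - g i x) + (f y - g i y) by ring.
  rewrite (le_trans (ler_modulusD _ _))// mulrDl lerD// modulusM -mulrA.
  by rewrite ler_wpM2l ?modulus_ge0.
- exists 4 => x; have := fP x 0%N; rewrite g0 subr0 expr0; lra.
- move=> x B xB; have [l lP] := geometric_limit xB.
  by rewrite (uniq (g^~ x) _ _ _ _ (fP x) lP).
Qed.

(** Otherwise there are vectors [x i] of the sequence and functionals [h i] of
the family such that [h i (x i)] exceeds [32 ^ i] in modulus and is, up to a
factor 2, the largest value at [x i] of a functional of the family. A sum of
terms [+- 16 ^- i * h i] then defines a bounded functional: with suitable signs
its [i]-th partial sum is at least [16 ^- i * h i (x i)] in modulus at [x i],
the tail of the series is at most half of that, and so the values at the [x i]
are unbounded. *)
Lemma uniform_boundedness (J : Type) (f : J -> V -> R[i]) (v : nat -> V) :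
  (forall j a x y, f j (a *: x + y) = a * f j x + f j y) ->
  (forall j x, modulus (f j x) <= rnorm x) ->
  (forall g, bounded_functional g ->
     exists B : R, forall n, modulus (g (v n)) <= B) ->
  exists B : R, forall n j, modulus (f j (v n)) <= B.
Proof.
move=> flin fle wb; apply: contrapT => nB.
have near_max (B : R) : exists p : nat * J, B < modulus (f p.2 (v p.1)) /\
    forall j, modulus (f j (v p.1)) <= 2 * modulus (f p.2 (v p.1)).
  have [n [j hj]] : exists n j, 2 * `|B| < modulus (f j (v n)).
    apply: contrapT => h; apply: nB; exists (2 * `|B|) => n j.
    by rewrite leNgt; apply/negP => h'; apply: h; exists n, j.
  pose S := range (fun j => modulus (f j (v n))).
  have hs : has_sup S.
    split; first by exists (modulus (f j (v n))), j.
    by exists (rnorm (v n)) => _ [i _ <-].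
  have ubS i : modulus (f i (v n)) <= sup S.
    by apply: sup_upper_bound => //; exists i.
  have S0 : 0 < sup S.
    by apply: lt_le_trans (ubS j); rewrite (le_lt_trans _ hj)// mulr_ge0.
  have [_ [j' _ <-] hj'] := sup_adherent (divr_gt0 S0 (ltr0Sn R 1)) hs.
  exists (n, j'); split => /=.
    by have := ler_norm B; have := ubS j; lra.
  by move=> i; have := ubS i; lra.
have /choice[p pP] := fun i : nat => near_max (32 ^+ i).
pose x i := v (p i).1; pose h i := f (p i).2.
(* Of [A + b] and [A - b], one has modulus at least that of [b]: whatever the
   previous partial sum, a sign keeps the new one as large as its last term. *)
pose sgn (A b : R[i]) : R[i] := if modulus b <= modulus (A + b) then 1 else -1.
have sgnP A b : modulus b <= modulus (A + sgn A b * b).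
  rewrite /sgn; case: ifPn; first by rewrite mul1r.
  rewrite -ltNge mulN1r => hb.
  have := ler_modulusD (A + b) (- (A - b)).
  have -> : A + b - (A - b) = 2%:C * b.
    by rewrite (_ : 2%:C = 2) ?rmorph_nat//; ring.
  rewrite modulusN modulusM modulus_real ger0_norm//; lra.
have sgn1 A b : modulus (sgn A b) = 1.
  by rewrite /sgn; case: ifP => _; rewrite ?modulusN modulus1.
pose q : R[i] := (16^-1)%:C.
have qX i : modulus (q ^+ i) = 16^-1 ^+ i.
  by rewrite /q -rmorphXn modulus_real ger0_norm// exprn_ge0.
pose step i (G : V -> R[i]) := sgn (G (x i)) (q ^+ i * h i (x i)) * q ^+ i.
pose g := fix g i := if i is i'.+1
  then fun y => g i' y + step i' (g i') * h i' y else fun=> 0.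
have gS i y : g i.+1 y = g i y + step i (g i) * h i y by [].
have stepE i G : modulus (step i G) = 16^-1 ^+ i.
  by rewrite modulusM sgn1 mul1r qX.
have dg i y : modulus (g i.+1 y - g i y) = modulus (h i y) * 16^-1 ^+ i.
  by rewrite gS addrAC subrr add0r modulusM stepE mulrC.
have q0 i : 0 <= (16^-1 : R) ^+ i by rewrite exprn_ge0.
have [|||F [Fb FP]] := @geometric_functional_limit g.
- by elim=> [|i IH] a y z; rewrite ?gS /= ?IH /h ?flin; ring.
- by [].
- by move=> i y; rewrite dg ler_wpM2r// fle.
have [B BP] := wb F Fb.
have [i Bi] : exists i : nat, B < 2 ^+ i / 2.
  (* half of [2 ^ i] is what the tail leaves of [16 ^- i * 32 ^ i] *)
  exists (Num.bound `|B|).+1; rewrite exprS mulrAC divff// mul1r.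
  apply: le_lt_trans (ler_norm B) _.
  apply: lt_le_trans (archi_boundP (normr_ge0 _)) _.
  by rewrite -natrX ler_nat ltnW// ltn_expl.
have := BP (p i).1; rewrite -/(x i); apply/negP; rewrite -ltNge.
have [big max] := pP i; set a := modulus (f (p i).2 (v (p i).1)) in big max.
have hi : 16^-1 ^+ i * a <= modulus (g i.+1 (x i)).
  have := sgnP (g i (x i)) (q ^+ i * h i (x i)).
  by rewrite modulusM qX gS /step mulrA.
have rem : modulus (F (x i) - g i.+1 (x i)) <= 4 * (2 * a) * 16^-1 ^+ i.+1.
  by apply: FP => j; rewrite dg ler_wpM2r//; exact: max.
have := le_modulus_sub (g i.+1 (x i)) (F (x i)); rewrite modulusB => tri.
have two : (2 : R) ^+ i <= 16^-1 ^+ i * a.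
  apply: (@le_trans _ _ (16^-1 ^+ i * 32 ^+ i)); last by rewrite ler_wpM2l ?ltW.
  by rewrite -exprMn (_ : 16^-1 * 32 = 2 :> R)//; lra.
rewrite exprS in rem; lra.
Qed.

End GlidingHump.

(** * Spaces of two-sided sequences *)

Definition combination (R : realType) (V : normedModType R[i]) (e : int -> V)
  (s : seq (int * R[i])) : V := \sum_(t <- s) t.2 *: e t.1.

Section Combination.
Variables (R : realType) (V : normedModType R[i]).
Variables (e : int -> V) (c : V -> int -> R[i]).
Hypothesis clin : forall a x y n, c (a *: x + y) n = a * c x n + c y n.
Hypothesis cbasis : forall n m, c (e n) m = (m == n)%:R.

Lemma entry_combination s m :
  c (combination e s) m = \sum_(t <- s) t.2 * (m == t.1)%:R.
Proof.
have c0 : c 0 m = 0.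
  have := clin 1 0 0 m; rewrite scale1r addr0 mul1r => h.
  by apply: (addrI (c 0 m)); rewrite -h addr0.
rewrite /combination; elim: s => [|t s IH]; first by rewrite !big_nil.
by rewrite !big_cons clin cbasis IH.
Qed.

Lemma entry_restriction x (s : seq int) m : uniq s ->
  c (x - combination e [seq (n, c x n) | n <- s]) m =
  if m \in s then 0 else c x m.
Proof.
rewrite -scaleN1r addrC clin entry_combination big_map /= => us.
case: ifP => ms.
  rewrite (bigD1_seq m)//= eqxx mulr1 big1 ?addr0 ?mulN1r ?addNr// => n.
  by rewrite eq_sym => /negPf ->; rewrite mulr0.
rewrite big_seq big1 ?mulr0 ?add0r// => n ns.
by case: eqP => [mn|_]; rewrite ?mulr0//; move: ms; rewrite mn ns.
Qed.

End Combination.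

(** What the argument uses of l_p(Z) and c_0(Z), [c x n] being the [n]-th entry
of [x]. Completeness enters through sequences whose entries are eventually
constant: the entries of the limit are then known beforehand and only its norm
has to be estimated. The bounds [b k] have to be arbitrarily small for the
limit to vanish at infinity in c_0. *)
Record sequence_space (R : realType) (V : normedModType R[i])
    (e : int -> V) (c : V -> int -> R[i]) : Prop := SequenceSpace {
  entry_linear : forall a x y n, c (a *: x + y) n = a * c x n + c y n;
  entry_inj : forall x, (forall n, c x n = 0) -> x = 0;
  entry_basis : forall n m, c (e n) m = (m == n)%:R;
  entry_le : forall x n, modulus (c x n) <= rnorm x;
  rnorm_basis : forall n, rnorm (e n) <= 1;
  combination_dense : forall x (d : R), 0 < d ->
    exists s, rnorm (x - combination e s) <= d;
  stationary_limit : forall (u : nat -> V) (b : nat -> R),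
    (forall d : R, 0 < d -> exists k, b k < d) ->
    (forall k l, (k <= l)%N -> rnorm (u l - u k) <= b k) ->
    (forall n, exists k, forall l, (k <= l)%N -> c (u l) n = c (u k) n) ->
    exists x, forall k, rnorm (x - u k) <= b k
}.

Section SequenceSpace.
Variables (R : realType) (V : normedModType R[i]).
Variables (e : int -> V) (c : V -> int -> R[i]).
Hypothesis sp : sequence_space e c.

Lemma entryD x y n : c (x + y) n = c x n + c y n.
Proof. by have := entry_linear sp 1 x y n; rewrite scale1r mul1r. Qed.

Lemma entry0 n : c 0 n = 0.
Proof. by apply: (addrI (c 0 n)); rewrite -entryD !addr0. Qed.

Lemma entryZ a x n : c (a *: x) n = a * c x n.
Proof. by have := entry_linear sp a x 0 n; rewrite entry0 !addr0. Qed.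

Lemma entryB x y n : c (x - y) n = c x n - c y n.
Proof. by rewrite -scaleN1r entryD entryZ mulN1r. Qed.

Definition support_radius (s : seq (int * R[i])) : nat :=
  \max_(t <- s) `|t.1|%N.

Lemma le_support_radius s t : t \in s -> (`|t.1| <= support_radius s)%N.
Proof. by move=> ts; exact: (leq_bigmax_seq (F := fun t => `|t.1|%N)). Qed.

Lemma entry_out s m : (support_radius s < `|m|)%N -> c (combination e s) m = 0.
Proof.
move=> sm; rewrite (entry_combination (entry_linear sp) (entry_basis sp)).
rewrite big_seq big1// => t /le_support_radius ts.
case: eqP => [mt|]; last by rewrite mulr0.
by move: sm; rewrite mt ltnNge ts.
Qed.

(** A combination at distance [d] has no entries far out, so those of [x] are
at most [d] there. *)
Lemma entry_vanish x (d : R) : 0 < d ->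
  exists N, forall n : int, (N < `|n|)%N -> modulus (c x n) <= d.
Proof.
move=> d0; have [s xs] := combination_dense sp x d0.
exists (support_radius s) => n /entry_out sn; apply: le_trans xs.
by rewrite -[c x n]subr0 -sn -entryB (entry_le sp).
Qed.

Lemma entry_bounded_functional n : bounded_functional (c^~ n).
Proof.
split=> [a x y|]; first exact: (entry_linear sp).
by exists 1 => x; rewrite mul1r (entry_le sp).
Qed.

Lemma weak_cvg_bounded (v : nat -> V) (y : V) :
  (v n : weak_space V) @[n --> \oo] --> (y : weak_space V) ->
  exists B : R, forall n j, modulus (c (v n) j) <= B.
Proof.
move=> vy; apply: (@uniform_boundedness R V int (fun j x => c x j)).
- by move=> j a u z; exact: (entry_linear sp).
- by move=> j u; exact: (entry_le sp).
move=> g /weak_cvg_functional/(_ vy)/(_ 1 ltr01)[N vN].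
exists (1 + modulus (g y) + \sum_(i < N) modulus (g (v i))) => n.
have s0 (P : pred 'I_N) : 0 <= \sum_(i < N | P i) modulus (g (v i)).
  by apply: sumr_ge0 => i _; exact: modulus_ge0.
have [nN|Nn] := ltnP n N.
  rewrite (bigD1 (Ordinal nN))//=; have := modulus_ge0 (g y).
  by have := s0 (fun i => i != Ordinal nN); lra.
have := le_modulus_sub (g (v n)) (g y); have := vN _ Nn.
by have := s0 xpredT; lra.
Qed.

End SequenceSpace.

(** The indices [j] with [`|j| <= q] form the window of radius [q]; it is
finite, so properties that hold eventually at each index hold eventually on it.
*)
Lemma window_uniform (q : nat) (P : int -> nat -> Prop) :
  (forall j : int, (`|j| <= q)%N -> exists N, forall n, (N <= n)%N -> P j n) ->
  exists N, forall n, (N <= n)%N -> forall j : int, (`|j| <= q)%N -> P j n.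
Proof.
elim: q => [|q IH] h.
  have [N NP] := h 0 isT; exists N => n Nn j j0.
  by rewrite (_ : j = 0); [exact: NP|lia].
have [|N NP] := IH; first by move=> j jq; apply: h; exact: leqW.
have [N1 NP1] := h q.+1%:Z (leqnn _).
have [|N2 NP2] := h (- q.+1%:Z); first by rewrite abszN.
exists (maxn N (maxn N1 N2)) => n; rewrite !geq_max => /and3P[nN nN1 nN2] j jq.
have [jq'|jq'] := leqP `|j| q; first exact: NP.
have [->|->] : j = q.+1%:Z \/ j = - q.+1%:Z by lia.
  exact: NP1.
exact: NP2.
Qed.

Section Window.
Variables (R : realType) (V : normedModType R[i]).
Variables (e : int -> V) (c : V -> int -> R[i]).
Hypothesis sp : sequence_space e c.

Fixpoint window_vector (q : nat) : V :=
  if q is q'.+1 then window_vector q' + (e q%:Z + e (- q%:Z)) else e 0.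

Lemma entry_window_vector q m : c (window_vector q) m = (`|m| <= q)%N%:R.
Proof.
elim: q => [|q IH] /=.
  by rewrite (entry_basis sp); congr (nat_of_bool _)%:R; lia.
rewrite !(entryD sp) IH !(entry_basis sp) -!natrD; congr (_%:R); lia.
Qed.

Lemma window_lower_bound q y : (forall j : int, (`|j| <= q)%N -> c y j != 0) ->
  exists2 d : R, 0 < d & forall j : int, (`|j| <= q)%N -> d <= modulus (c y j).
Proof.
move=> y0; have [|N NP] := @window_uniform q
    (fun j n => n.+1%:R^-1 <= modulus (c y j)).
  move=> j /y0; rewrite -modulus_gt0 => yj.
  have [N NP] := harmonic_lt yj.
  by exists N => n /NP /ltW.
by exists N.+1%:R^-1 => // j jq; exact: NP.
Qed.

Lemma window_near q (v : nat -> V) y (d : R) : 0 < d ->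
  (v n : weak_space V) @[n --> \oo] --> (y : weak_space V) ->
  exists N, forall n, (N <= n)%N -> forall j : int, (`|j| <= q)%N ->
    modulus (c (v n) j - c y j) < d.
Proof.
move=> d0 vy; apply: (@window_uniform q
  (fun j n => modulus (c (v n) j - c y j) < d)) => j _.
exact: weak_cvg_functional (entry_bounded_functional sp j) vy d d0.
Qed.

End Window.

Lemma frequently_const (n : nat -> nat) N :
  (forall K, exists2 k, (K <= k)%N & (n k < N)%N) ->
  exists m, forall K, exists2 k, (K <= k)%N & n k = m.
Proof.
elim: N => [|N IH] h; first by have [] := h 0%N.
have [hN|/existsNP[K0 hK0]] :=
  pselect (forall K, exists2 k, (K <= k)%N & n k = N); first by exists N.
apply: IH => K; have [k] := h (maxn K K0).
rewrite geq_max => /andP[Kk K0k] nk; exists k => //.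
rewrite ltn_neqAle -ltnS nk andbT; apply/eqP => nkN.
by apply: hK0; exists k.
Qed.

Lemma injective_unbounded (n : nat -> nat) : injective n ->
  forall N, exists K, forall k, (K <= k)%N -> (N <= n k)%N.
Proof.
move=> ninj; elim=> [|N [K KP]]; first by exists 0%N.
have [[k0 nk0]|hN] := pselect (exists k, n k = N); last first.
  exists K => k /KP; rewrite leq_eqVlt => /predU1P[nk|//].
  by case: hN; exists k.
exists (maxn K k0.+1) => k; rewrite geq_max => /andP[/KP nk kk0].
rewrite ltn_neqAle nk andbT -nk0; apply/eqP => /ninj kk; move: kk0.
by rewrite kk ltnn.
Qed.

(** * Weighted shifts and Salas' condition *)

(** [scalar_closed] says that [L] is closed in the punctured plane: when the
iterates in a convergent sequence are all equal, it keeps the limit in the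
orbit. *)
Record scalar_group (R : realType) (L : set R[i]) : Prop := ScalarGroup {
  scalar_neq0 : forall a, L a -> a != 0;
  scalar_div : forall a b, L a -> L b -> L (a / b);
  scalar_closed : forall a, a != 0 ->
    (forall d : R, 0 < d -> exists2 b, L b & modulus (b - a) < d) -> L a
}.

Section Shift.
Variables (R : realType) (V : normedModType R[i]).
Variables (e : int -> V) (c : V -> int -> R[i]).
Hypothesis sp : sequence_space e c.
Variables (w : int -> R[i]) (T : {linear V -> V}).

(** The coefficient of [iter n T (e j)] along [e (j - n)]. *)
Definition weight_product n j : R[i] := \prod_(i < n) w (j - i%:Z).

Definition scalar_orbit (L : set R[i]) x : set V :=
  [set y | exists a n, L a /\ y = a *: iter n T x].

Definition salas_condition (L : set R[i]) :=
  forall (q N : nat) (d : R), 0 < d -> exists n a, [/\ (N <= n)%N, L a &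
    forall j : int, (`|j| <= q)%N ->
      modulus (a * weight_product n j) <= d /\
      1 <= d * modulus (a * weight_product n (j + n%:Z))].

Hypothesis Tshift : bilateral_weighted_shift e w T.

Lemma shift_bound :
  exists2 M : R, 1 <= M & forall x, rnorm (T x) <= M * rnorm x.
Proof.
have [_ _ [M TM] _] := Tshift; exists (modulus M + 1).
  by rewrite lerDr modulus_ge0.
move=> x; have := TM x; rewrite !rnormE => h.
have X0 : 0 <= M * (rnorm x)%:C by apply: le_trans h; rewrite ler0c rnorm_ge0.
move: h; rewrite -(ger0_norm X0).
rewrite modulusE lecR modulusM modulus_real ger0_norm ?rnorm_ge0//.
by have := rnorm_ge0 x; nra.
Qed.

Lemma iter_linear n a x y :
  iter n T (a *: x + y) = a *: iter n T x + iter n T y.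
Proof. by elim: n => //= n ->; rewrite linearP. Qed.

Lemma iterZ n a x : iter n T (a *: x) = a *: iter n T x.
Proof. by elim: n => //= n ->; rewrite linearZ. Qed.

Lemma weight_productS n j :
  weight_product n.+1 j = weight_product n j * w (j - n%:Z).
Proof. by rewrite /weight_product big_ord_recr. Qed.

Lemma iter_basis n j : iter n T (e j) = weight_product n j *: e (j - n%:Z).
Proof.
elim: n => [|n IH]; first by rewrite /weight_product big_ord0 scale1r subr0.
have [_ _ _ Te] := Tshift.
rewrite iterS IH linearZ /= Te scalerA weight_productS; congr (_ *: e _); lia.
Qed.

(** On combinations of the basis this is a computation; both sides are
continuous in [x] and combinations are dense. *)
Lemma entry_shift x j : c (T x) j = w (j + 1) * c x (j + 1).
Proof.
have [_ _ _ Te] := Tshift; have [M M1 TM] := shift_bound.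
have onbasis m : c (T (e m)) j = w (j + 1) * c (e m) (j + 1).
  rewrite Te (entryZ sp) !(entry_basis sp).
  have -> : (j == m - 1) = (j + 1 == m) by lia.
  by case: eqP => [->|]; rewrite ?mulr0.
have oncomb s :
    c (T (combination e s)) j = w (j + 1) * c (combination e s) (j + 1).
  rewrite /combination; elim: s => [|t s IH].
    by rewrite big_nil linear0 !(entry0 sp) mulr0.
  rewrite big_cons linearP (entry_linear sp) IH (entry_linear sp) onbasis; ring.
apply/eqP; rewrite -subr_eq0 -[_ == 0]negbK -modulus_gt0; apply/negP => h.
set D := modulus _ in h; pose K := M + modulus (w (j + 1)).
have K1 : 1 <= K by rewrite ler_wpDr ?modulus_ge0.
have K0 : 0 < 1 + K by rewrite ltr_wpDr// (le_trans ler01).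
have [s] := combination_dense sp x (divr_gt0 h K0).
set r := rnorm _ => hr.
have : D <= K * r.
  rewrite /D; have -> : c (T x) j - w (j + 1) * c x (j + 1) =
      c (T (x - combination e s)) j
      - w (j + 1) * c (x - combination e s) (j + 1).
    by rewrite linearB !(entryB sp) oncomb; ring.
  rewrite (le_trans (ler_modulusD _ _))// modulusN modulusM mulrDl lerD//.
    exact: le_trans (entry_le sp _ _) (TM _).
  by rewrite ler_wpM2l ?modulus_ge0// (entry_le sp).
apply/negP; rewrite -ltNge; move: hr; rewrite ler_pdivlMr; last by lra.
rewrite mulrDr mulr1 => hr.
have : 0 <= r by exact: rnorm_ge0.
rewrite le_eqVlt => /predU1P[r0|]; last by nra.
by rewrite -r0 mulr0.
Qed.

Lemma entry_iter n x j :
  c (iter n T x) j = weight_product n (j + n%:Z) * c x (j + n%:Z).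
Proof.
elim: n j => [|n IH] j; first by rewrite /weight_product big_ord0 mul1r addr0.
rewrite iterS entry_shift IH weight_productS mulrA.
congr (_ * c x _); last by lia.
by rewrite mulrC; congr (weight_product n _ * w _); lia.
Qed.

(** * Weak sequential density implies Salas' condition *)

Section WeakOrbit.
Variables (L : set R[i]) (x : V).
Hypothesis Lgrp : scalar_group L.
Hypothesis xdense : forall A : set (weak_space V), seq_closed A ->
  scalar_orbit L x `<=` A -> A = setT.

(** If no such sequence exists, the union of the orbit and of the set [bad] of
vectors with a zero entry in the window is weakly sequentially closed: a
sequence in the union with limit [y] outside [bad] is eventually in the orbit,
and its exponents are bounded on a subsequence, hence constant on another one,
which puts [y] in the orbit. So the union is everything. The vectors [z i]
contradict this: they avoid [bad], hence lie in the orbit, and they have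
distinct directions, hence distinct exponents, and they converge. *)
Lemma orbit_weak_limit q : exists v y (a : nat -> R[i]) (n : nat -> nat),
  [/\ (v k : weak_space V) @[k --> \oo] --> (y : weak_space V),
      (forall k, L (a k) /\ v k = a k *: iter (n k) T x),
      (forall j : int, (`|j| <= q)%N -> c y j != 0) &
      forall N, exists K, forall k, (K <= k)%N -> (N <= n k)%N].
Proof.
apply: contrapT => nolim.
pose bad : set V := [set y | exists2 j : int, (`|j| <= q)%N & c y j = 0].
have nbadP y : ~ bad y -> forall j : int, (`|j| <= q)%N -> c y j != 0.
  by move=> h j jq; apply/eqP => yj; apply: h; exists j.
have AT : ((scalar_orbit L x `|` bad) : set (weak_space V)) = setT.
  apply: xdense; last by left.
  move=> u y uA uy; apply: contrapT => /not_orP[yO /nbadP y0].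
  have [d d0 yd] := window_lower_bound y0.
  have [K uK] := window_near sp q d0 uy.
  pose v k := u (K + k)%N.
  have vy : (v k : weak_space V) @[k --> \oo] --> (y : weak_space V).
    move=> B /uy[N _ NB]; exists N => // k /= Nk; apply: NB.
    by rewrite /= (leq_trans Nk)// leq_addl.
  have /choice[p pP] : forall k, exists p : R[i] * nat,
      L p.1 /\ v k = p.1 *: iter p.2 T x.
    move=> k; case: (uA (K + k)%N) => [[a [n [La un]]]|].
      by exists (a, n).
    move=> [j jq uj]; have := uK (K + k)%N (leq_addr _ _) j jq.
    by rewrite uj sub0r modulusN ltNge yd.
  have [pinf|/existsNP[N hN]] :=
      pselect (forall N, exists K, forall k, (K <= k)%N -> (N <= (p k).2)%N).
    by apply: nolim; exists v, y, (fun k => (p k).1), (fun k => (p k).2).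
  have [|m mP] := @frequently_const (fun k => (p k).2) N.
    move=> K'; apply: contrapT => hK; apply: hN; exists K' => k K'k.
    by rewrite leqNgt; apply/negP => pk; apply: hK; exists k.
  (* The scalars along the constant subsequence converge to the quotient of the
     entries of [y] and [z] at 0, an index that lies in every window. *)
  pose z := iter m T x.
  have near j (d' : R) : 0 < d' -> exists k, L (p k).1 /\
      forall i : int, i = 0 \/ i = j -> modulus ((p k).1 * c z i - c y i) < d'.
    move=> d'0; have [K' vK'] := window_near sp `|j| d'0 vy.
    have [k K'k pk] := mP K'; exists k; have [Lk vk] := pP k; split=> // i hi.
    by rewrite -(entryZ sp) /z -pk -vk; apply: vK' => //; case: hi => ->.
  have y00 := y0 0 isT.
  have z0 : c z 0 != 0.
    have [k [_ /(_ 0 (or_introl erefl))]] := near 0 _ d0.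
    by apply: contraTneq => ->; rewrite mulr0 sub0r modulusN -leNgt yd.
  apply: yO; exists (c y 0 / c z 0), m; split.
    apply: (scalar_closed Lgrp); first by rewrite mulf_neq0// invr_eq0.
    move=> d' d'0.
    have zd : 0 < d' * modulus (c z 0) by rewrite mulr_gt0// modulus_gt0.
    have [k [Lk /(_ 0 (or_introl erefl)) hk]] := near 0 _ zd.
    exists (p k).1 => //.
    rewrite -(ltr_pM2r (_ : 0 < modulus (c z 0))) ?modulus_gt0//.
    by rewrite -modulusM mulrBl divfK.
  apply/eqP; rewrite -subr_eq0; apply/eqP/(entry_inj sp) => j.
  rewrite (entryB sp) (entryZ sp) -/z; set b := _ / _.
  apply/eqP; rewrite -[_ == 0]negbK -modulus_gt0; apply/negP => h.
  set D := modulus _ in h.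
  have Z0 : 0 < modulus (c z 0) by rewrite modulus_gt0.
  pose K' := 1 + modulus (c z j) / modulus (c z 0).
  have K'1 : 1 <= K' by rewrite lerDl divr_ge0 ?modulus_ge0.
  have K'0 := lt_le_trans ltr01 K'1.
  have [k [_ hk]] := near j _ (divr_gt0 h K'0).
  have h0 := hk 0 (or_introl erefl); have hj := hk j (or_intror erefl).
  have : D < D / K' * K'; last by rewrite divfK ?gt_eqF// ltxx.
  rewrite {1}/D; have -> : c y j - b * c z j =
      (c y j - (p k).1 * c z j) + ((p k).1 * c z 0 - c y 0) * (c z j / c z 0).
    by rewrite /b; field.
  rewrite (le_lt_trans (ler_modulusD _ _))// /K' mulrDr mulr1 ltr_leD//.
    by rewrite modulusB.
  by rewrite modulusM modulusM modulusV ler_wpM2r ?divr_ge0 ?modulus_ge0 ?ltW.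
pose z i := i.+1%:R^-1 *: e q.+1%:Z + window_vector e q.
have cz i j : c (z i) j = i.+1%:R^-1 * (j == q.+1%:Z)%:R + (`|j| <= q)%N%:R.
  by rewrite (entry_linear sp) (entry_basis sp) (entry_window_vector sp).
(* The entry at 0 fixes the scalar on each line; the entry at [q.+1] then tells
   the vectors [z i] apart. *)
have cz1 i (j : int) : (`|j| <= q)%N -> c (z i) j = 1.
  move=> jq; rewrite cz jq; case: eqP => [jq'|_]; last by rewrite mulr0 add0r.
  by move: jq; rewrite jq' ltnn.
have /choice[p pP] : forall k, exists p : R[i] * nat,
    L p.1 /\ z k = p.1 *: iter p.2 T x.
  move=> k; have : (scalar_orbit L x `|` bad) (z k) by rewrite AT.
  case=> [[a [n [La un]]]|[j jq /eqP]]; first by exists (a, n).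
  by rewrite cz1// oner_eq0.
apply: nolim.
exists z, (window_vector e q), (fun k => (p k).1), (fun k => (p k).2).
split=> //.
- apply: norm_cvg_weak => d d0.
  have [N NP] := harmonic_lt d0; exists N => n /NP.
  rewrite /z addrK rnormZ modulus_harmonic; apply: le_lt_trans.
  by rewrite -[leRHS]mulr1 ler_wpM2l// (rnorm_basis sp).
- by move=> j jq; rewrite (entry_window_vector sp) jq oner_eq0.
apply: injective_unbounded => i k pik.
have [_ zi] := pP i; have [_ zk] := pP k.
have := cz1 i 0 isT; have := cz1 k 0 isT.
rewrite zi zk !(entryZ sp) pik => hk hi.
have g0 : c (iter (p k).2 T x) 0 != 0.
  by apply: contra_eqN hk => /eqP->; rewrite mulr0 eq_sym oner_eq0.
have aik : (p i).1 = (p k).1 by apply: (mulIf g0); rewrite hi hk.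
have : c (z i) q.+1%:Z = c (z k) q.+1%:Z by rewrite zi zk aik pik.
rewrite !cz eqxx !mulr1 => /addIr/invr_inj/eqP.
by rewrite eqr_nat eqSS => /eqP.
Qed.

(** Otherwise the orbit lies in the set of vectors with an entry of modulus at
most [C] in the window, which is weakly sequentially closed but is not the
whole space. *)
Lemma orbit_large_window q (C : R) : exists u a n,
  [/\ L a, u = a *: iter n T x &
    forall j : int, (`|j| <= q)%N -> C <= modulus (c u j)].
Proof.
apply: contrapT => small.
pose A : set V :=
  [set y | exists2 j : int, (`|j| <= q)%N & modulus (c y j) <= C].
have AT : (A : set (weak_space V)) = setT.
  apply: xdense => [u y uA uy|_ [a [n [La ->]]]].
    apply: contrapT => nAy.
    have [|N NP] := @window_uniform q (fun j n => C < modulus (c (u n) j)).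
      move=> j jq; have yj : 0 < modulus (c y j) - C.
        by rewrite subr_gt0 ltNge; apply/negP => h; apply: nAy; exists j.
      have [N NP] := weak_cvg_functional (entry_bounded_functional sp j) uy yj.
      exists N => n /NP; have := le_modulus_sub (c y j) (c (u n) j).
      rewrite modulusB; lra.
    by have [j jq] := uA N; rewrite leNgt NP.
  apply: contrapT => nA; apply: small.
  exists (a *: iter n T x), a, n; split=> // j jq.
  apply: contrapT => /negP; rewrite -ltNge => h; apply: nA.
  by exists j => //; exact: ltW.
have : A ((`|C| + 1)%:C *: window_vector e q) by rewrite AT.
move=> [j jq]; rewrite (entryZ sp) (entry_window_vector sp) jq mulr1.
by rewrite modulus_real ger0_norm ?addr_ge0//; have := ler_norm C; lra.
Qed.

Theorem weak_orbit_salas : salas_condition L.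
Proof.
move=> q N d d0.
have [v [y [a [n [vy va y0 ninf]]]]] := orbit_weak_limit q.
have [B0 B0P] := weak_cvg_bounded sp vy.
pose B := `|B0| + 1; have Bpos : 0 < B by rewrite ltr_wpDl.
have BP k j : modulus (c (v k) j) <= B.
  by have := B0P k j; have := ler_norm B0; rewrite /B; lra.
have [d1 d10 yd1] := window_lower_bound y0.
have d12 : 0 < d1 / 2 by rewrite divr_gt0.
have [K1 K1P] := window_near sp q d12 vy.
have [u [b [m [Lb ub uC]]]] := orbit_large_window q (B / d).
have [N1 N1P] := entry_vanish sp u (mulr_gt0 d0 d12).
have [K2 K2P] := ninf (m + N + N1 + q).+1.
(* [n k] is taken beyond [m] so that [v k] is a scaled iterate of [u], beyond
   [N] as the condition demands, and beyond [N1 + q] so that the entries of [u]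
   that reach the window are already small. *)
pose k := maxn K1 K2.
have kK1 : (K1 <= k)%N by exact: leq_maxl.
have := K2P k (leq_maxr _ _) => nk.
have [La vk] := va k; have b0 := scalar_neq0 Lgrp Lb.
pose n' := (n k - m)%N.
have vku : v k = (a k / b) *: iter n' T u.
  rewrite vk ub iterZ scalerA divfK// -iterD.
  by congr (_ *: iter _ _ _); rewrite /n'; lia.
exists n', (a k / b); split; [rewrite /n'; lia|exact: (scalar_div Lgrp)|].
move=> j jq; split.
  have := BP k (j - n'%:Z); rewrite vku (entryZ sp) entry_iter subrK mulrA.
  rewrite (modulusM (a k / b * weight_product n' j)).
  have := uC j jq; have := modulus_ge0 (a k / b * weight_product n' j).
  move: (modulus (a k / b * _)) (modulus (c u j)) => W U W0.
  rewrite ler_pdivrMr// => BU WU.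
  rewrite leNgt; apply/negP => dW.
  have U0 : 0 < U by rewrite -(pmulr_lgt0 _ d0) (lt_le_trans Bpos).
  have : d * U < W * U by rewrite ltr_pM2r.
  by lra.
have vd : d1 / 2 <= modulus (c (v k) j).
  have := le_modulus_sub (c y j) (c (v k) j); rewrite modulusB.
  by have := K1P k kK1 j jq; have := yd1 j jq; lra.
have ud : modulus (c u (j + n'%:Z)) <= d * (d1 / 2).
  by apply: N1P; rewrite /n'; lia.
move: vd; rewrite vku (entryZ sp) entry_iter mulrA.
rewrite (modulusM (a k / b * weight_product n' (j + n'%:Z))).
have := modulus_ge0 (a k / b * weight_product n' (j + n'%:Z)).
move: (modulus (a k / b * _)) (modulus (c u _)) ud => W U ud W0 dWU.
have : d1 / 2 <= W * (d * (d1 / 2)) by apply: le_trans dWU _; rewrite ler_wpM2l.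
by rewrite mulrA -[X in X <= _]mul1r ler_pM2r// mulrC.
Qed.

End WeakOrbit.

End Shift.

(** * Salas' condition yields a norm dense orbit *)

Section Construction.
Variables (R : realType) (V : normedModType R[i]).
Variables (e : int -> V) (c : V -> int -> R[i]).
Hypothesis sp : sequence_space e c.

Lemma combination_cat s t :
  combination e (s ++ t) = combination e s + combination e t.
Proof. exact: big_cat. Qed.

Lemma combination_cons t s :
  combination e (t :: s) = t.2 *: e t.1 + combination e s.
Proof. exact: big_cons. Qed.

Lemma rnorm_combination s :
  rnorm (combination e s) <= \sum_(t <- s) modulus t.2.
Proof.
elim: s => [|t s IH]; first by rewrite /combination !big_nil rnorm0.
rewrite combination_cons big_cons (le_trans (rnormD _ _))// lerD// rnormZ.
by rewrite -[leRHS]mulr1 ler_wpM2l ?modulus_ge0// (rnorm_basis sp).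
Qed.

Definition rational_complex (r : rat * rat) : R[i] := ratr r.1 +i* ratr r.2.

Definition rational_combination (s : seq (int * (rat * rat))) : V :=
  combination e [seq (t.1, rational_complex t.2) | t <- s].

Lemma rational_complex_dense (a : R[i]) (d : R) : 0 < d ->
  exists r, modulus (a - rational_complex r) <= d.
Proof.
move=> d0; have d2 : 0 < d / 2 by rewrite divr_gt0.
have approx (u : R) : exists r : rat, `|u - ratr r| <= d / 2.
  have [|r] := @rat_in_itvoo R u (u + d / 2); first by rewrite ltrDl.
  rewrite in_itv /= => /andP[h1 h2]; exists r.
  by rewrite ler_norml; apply/andP; split; lra.
have [r hr] := approx (complex.Re a); have [s hs] := approx (complex.Im a).
exists (r, s); case: (modulus_ReIm (a - rational_complex (r, s))) => _ _.
rewrite !raddfB /=; lra.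
Qed.

Lemma rational_combination_dense x (d : R) : 0 < d ->
  exists s, rnorm (x - rational_combination s) <= d.
Proof.
move=> d0; have d2 : 0 < d / 2 by rewrite divr_gt0.
have [s xs] := combination_dense sp x d2.
suff [r sr] : exists r,
    rnorm (combination e s - rational_combination r) <= d / 2.
  exists r; rewrite (_ : x - _ = (x - combination e s) +
    (combination e s - rational_combination r)); last by rewrite addrA subrK.
  by apply: le_trans (rnormD _ _) _; lra.
elim: s (d / 2) d2 {xs} => [|[j a] s IH] d' d'0.
  by exists [::]; rewrite /rational_combination /= subrr rnorm0 ltW.
have d'2 : 0 < d' / 2 by rewrite divr_gt0.
have [r rs] := IH _ d'2; have [p pa] := rational_complex_dense a d'2.
exists ((j, p) :: r); rewrite /rational_combination /= !combination_cons /=.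
rewrite opprD addrACA -scalerBl (le_trans (rnormD _ _))// [leRHS]splitr lerD//.
rewrite rnormZ (le_trans _ pa)// -[leRHS]mulr1 ler_wpM2l ?modulus_ge0//.
exact: (rnorm_basis sp).
Qed.

(** The 2-adic valuation takes every value infinitely often, so every rational
combination is the target of arbitrarily late, hence arbitrarily precise,
steps. *)
Definition target (k : nat) : seq (int * (rat * rat)) :=
  odflt [::] (unpickle (logn 2 k)).

Lemma target_frequently s K : exists2 k, (K <= k)%N & target k = s.
Proof.
exists (2 ^ pickle s * K.*2.+1)%N; last first.
  rewrite /target lognM ?expn_gt0// pfactorK// logn_coprime ?addn0 ?pickleK//.
  by rewrite coprime2n /= odd_double.
by apply: leq_trans (leq_pmull _ _); rewrite ?expn_gt0// -addnn leqW// leq_addr.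
Qed.

Variables (w : int -> R[i]) (T : {linear V -> V}).
Hypothesis Tshift : bilateral_weighted_shift e w T.
Variable L : set R[i].

Lemma iter_combination n a s : a *: iter n T (combination e s) =
  combination e [seq (t.1 - n%:Z, a * weight_product w n t.1 * t.2) | t <- s].
Proof.
elim: s => [|t s IH].
  rewrite /combination !big_nil -[0](scale0r 0) (iterZ T) scalerA mulr0.
  by rewrite !scale0r.
rewrite combination_cons /= combination_cons -IH (iter_linear T).
by rewrite (iter_basis Tshift) scalerDr !scalerA mulrAC.
Qed.

(** The vector [t] is the image of [y] under the formal inverse of [a *: T^n],
which is small because [a * W n (j + n)] is large on the support of [y]; the
sum [s] of the terms already chosen is almost annihilated because [a * W n j]
is small on its support. Since [t] is supported near [n], large [n] makes it
vanish on the window of radius [N]. *)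
Lemma salas_approximation_step :
  salas_condition w L -> forall y s N (d : R), 0 < d ->
  exists n a t, [/\ L a,
    a *: iter n T (combination e t) = combination e y,
    rnorm (combination e t) <= d,
    rnorm (a *: iter n T (combination e s)) <= d &
    forall j : int, (`|j| <= N)%N -> c (combination e t) j = 0].
Proof.
move=> hL y s N d d0; pose q := maxn (support_radius y) (support_radius s).
pose l1 (u : seq (int * R[i])) := \sum_(t <- u) modulus t.2.
have l10 u : 0 <= l1 u by apply: sumr_ge0 => t _; exact: modulus_ge0.
pose D := 1 + l1 y + l1 s.
have D0 : 0 < D by rewrite /D -addrA ltr_pwDl// addr_ge0.
have l1D u d' : 0 <= d' -> l1 u <= D -> d' <= d / D -> d' * l1 u <= d.
  move=> d'0 uD d'D; apply: (@le_trans _ _ (d / D * D)); last first.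
    by rewrite divfK ?gt_eqF.
  by rewrite ler_pM.
have [n [a [Nn La aW]]] := hL q (N + q).+1 (d / D) (divr_gt0 d0 D0).
pose W j := a * weight_product w n j.
pose t := [seq (p.1 + n%:Z, (W (p.1 + n%:Z))^-1 * p.2) | p <- y].
have yq p : p \in y -> (`|p.1| <= q)%N.
  by move=> /le_support_radius /leq_trans; apply; exact: leq_maxl.
have sq p : p \in s -> (`|p.1| <= q)%N.
  by move=> /le_support_radius /leq_trans; apply; exact: leq_maxr.
have W0 p : p \in y -> W (p.1 + n%:Z) != 0.
  move=> /yq /aW[_]; rewrite -modulus_gt0 -/(W _) => h.
  rewrite lt_neqAle modulus_ge0 andbT eq_sym; apply/eqP => W0.
  by move: h; rewrite W0 mulr0 ler10.
have dD := divr_ge0 (ltW d0) (ltW D0).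
exists n, a, t; split=> //.
- rewrite iter_combination /t -map_comp; congr combination.
  rewrite -[RHS]map_id; apply/eq_in_map => -[j b] /W0 /= jb.
  by rewrite addrK mulrA divff// mul1r.
- rewrite (le_trans (rnorm_combination _))// big_map /=.
  apply: le_trans (l1D y _ dD _ (lexx _)); last first.
    by rewrite /D; have := l10 s; lra.
  rewrite /l1 mulr_sumr big_seq [leRHS]big_seq; apply: ler_sum => p py.
  rewrite modulusM ler_wpM2r ?modulus_ge0// modulusV.
  have [_] := aW _ (yq _ py); rewrite -/(W _) => h.
  by rewrite -[leLHS]mul1r ler_pdivrMr// modulus_gt0 W0.
- rewrite iter_combination (le_trans (rnorm_combination _))// big_map /=.
  apply: le_trans (l1D s _ dD _ (lexx _)); last first.
    by rewrite /D; have := l10 y; lra.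
  rewrite /l1 mulr_sumr big_seq [leRHS]big_seq; apply: ler_sum => p ps.
  rewrite modulusM ler_wpM2r ?modulus_ge0//.
  by have [] := aW _ (sq _ ps).
move=> j jN.
rewrite (entry_combination (entry_linear sp) (entry_basis sp)) big_map big_seq.
rewrite big1// => p /yq pq /=.
case: eqP => [/= jp|_]; last by rewrite mulr0.
have jE : j = (p.1 : int) + n%:Z := jp.
exfalso; clear - Nn pq jN jE; move: Nn pq jN; rewrite jE.
by move: (p.1) q => i q'; lia.
Qed.

(** The [k]-th term is [u k] and [s k] is the sum of the earlier ones. The
number [C k] exceeds the norms of all operators [a i *: T^(n i)] with [i < k];
dividing the [k]-th error by it keeps the effect of all later terms on the
[i]-th step at most [2^-1 ^+ i]. The terms vanish on growing windows, so the
partial sums are eventually constant at each index. *)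
Theorem salas_dense_orbit : salas_condition w L -> exists x, forall z (d : R),
  0 < d -> exists2 y, scalar_orbit T L x y & rnorm (z - y) < d.
Proof.
move=> hL; have [M M1 TM] := shift_bound Tshift.
have M0 : 0 <= M by exact: le_trans M1.
have iterM n x : rnorm (iter n T x) <= M ^+ n * rnorm x.
  elim: n => [|n IH]; first by rewrite mul1r.
  by rewrite iterS exprS -mulrA (le_trans (TM _))// ler_wpM2l.
pose Y k := [seq (t.1, rational_complex t.2) | t <- target k].
have /choice[f fP] : forall p : nat * (seq (int * R[i]) * R),
  exists r : nat * R[i] * seq (int * R[i]), 0 < p.2.2 ->
    [/\ L r.1.2,
    r.1.2 *: iter r.1.1 T (combination e r.2) = combination e (Y p.1),
    rnorm (combination e r.2) <= 2^-1 ^+ p.1 / p.2.2,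
    rnorm (r.1.2 *: iter r.1.1 T (combination e p.2.1)) <= 2^-1 ^+ p.1 / p.2.2 &
    forall j : int, (`|j| <= p.1)%N -> c (combination e r.2) j = 0].
  move=> [k [s C]] /=; have [C0|C0] := boolP (0 < C); last first.
    by exists (0%N, 0, [::]).
  have kC : 0 < 2^-1 ^+ k / C by rewrite divr_gt0// exprn_gt0.
  have [n [a [t h]]] := salas_approximation_step hL (Y k) s k kC.
  by exists (n, a, t).
pose st := fix st k : seq (int * R[i]) * R := if k is k'.+1 then
  let r := f (k', st k') in
  (r.2 ++ (st k').1, (st k').2 + modulus r.1.2 * M ^+ r.1.1) else ([::], 1).
pose n k := (f (k, st k)).1.1.
pose a k := (f (k, st k)).1.2.
pose u k := combination e (f (k, st k)).2.
pose s k := combination e (st k).1.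
pose C k := (st k).2.
have sS k : s k.+1 = u k + s k by rewrite /s /= combination_cat.
have CS k : C k.+1 = C k + modulus (a k) * M ^+ n k by [].
have aM0 k : 0 <= modulus (a k) * M ^+ n k.
  by rewrite mulr_ge0 ?modulus_ge0 ?exprn_ge0.
have C1 k : 1 <= C k by elim: k => [//|k IH]; rewrite CS ler_wpDr.
have C0 k : 0 < C k by exact: lt_le_trans (C1 k).
have h0 k : 0 <= (2^-1 : R) ^+ k by rewrite exprn_ge0.
have stepP k := fP (k, st k) (C0 k); rewrite /= in stepP.
have [x xP] : exists x, forall k, rnorm (x - s k) <= 2 * 2^-1 ^+ k / C k.
  apply: (stationary_limit sp).
  - move=> d d0; have [N NP] := harmonic_lt d0; exists N.+1.
    apply: le_lt_trans (NP N (leqnn _)).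
    rewrite ler_pdivrMr// exprS mulrA divff// mul1r.
    apply: (@le_trans _ _ (N.+1%:R^-1 * 1)); last by rewrite ler_wpM2l.
    rewrite mulr1 exprVn lef_pV2 ?posrE ?exprn_gt0// -natrX ler_nat.
    exact: ltn_expl.
  - move=> k l /subnKC <-; move: (l - k)%N => {l}.
    have CK m : C k <= C (k + m)%N.
      elim: m => [|m IH]; first by rewrite addn0.
      by rewrite addnS CS ler_wpDr.
    suff H m : rnorm (s (k + m)%N - s k) <=
        2 * (2^-1 ^+ k - 2^-1 ^+ (k + m)%N) / C k.
      move=> m; apply: le_trans (H m) _.
      rewrite ler_wpM2r ?invr_ge0 ?(ltW (C0 k))//.
      by have := h0 (k + m)%N; lra.
    elim: m => [|m IH]; first by rewrite addn0 !subrr rnorm0 mulr0 mul0r.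
    rewrite addnS sS -addrA (le_trans (rnormD _ _))//.
    have [_ _ hu _ _] := stepP (k + m)%N.
    have {}hu : rnorm (u (k + m)%N) <= 2^-1 ^+ (k + m) / C k.
      apply: le_trans hu _; rewrite ler_wpM2l// lef_pV2 ?posrE ?CK//; exact: C0.
    apply: le_trans (lerD hu IH) _.
    rewrite -mulrDl ler_wpM2r ?invr_ge0 ?(ltW (C0 k))//.
    rewrite exprS; lra.
  - move=> j; exists `|j|%N => l /subnKC <-; elim: (l - `|j|)%N => [|m IH].
      by rewrite addn0.
    rewrite addnS sS (entryD sp) IH; have [_ _ _ _ hu] := stepP (`|j| + m)%N.
    by rewrite hu ?add0r// leq_addr.
exists x => z d d0.
have d4 : 0 < d / 4 by rewrite divr_gt0.
have [r zr] := rational_combination_dense z d4.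
have [N NP] := harmonic_lt d4.
have [k Nk rk] := target_frequently r N.
exists (a k *: iter (n k) T x).
  by exists (a k), (n k); have [La] := stepP k.
have [_ yk _ hs _] := stepP k.
have k4 : 2^-1 ^+ k < d / 4.
  apply: le_lt_trans (NP k Nk).
  by rewrite exprVn lef_pV2 ?posrE ?exprn_gt0// -natrX ler_nat ltn_expl.
have part1 : rnorm (a k *: iter (n k) T (x - s k.+1)) <= 2^-1 ^+ k.
  rewrite rnormZ; apply: (@le_trans _ _
      (modulus (a k) * (M ^+ n k * (2 * 2^-1 ^+ k.+1 / C k.+1)))).
    rewrite ler_wpM2l ?modulus_ge0// (le_trans (iterM _ _))//.
    by rewrite ler_wpM2l ?exprn_ge0.
  rewrite mulrA exprS [2 * _]mulrA divff// mul1r mulrCA.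
  rewrite -[leRHS]mulr1 ler_wpM2l//.
  by rewrite ler_pdivrMr// mul1r CS lerDr ltW.
have part2 : rnorm (a k *: iter (n k) T (s k)) <= 2^-1 ^+ k.
  apply: le_trans hs _; rewrite (ler_pdivrMr _ _ (C0 k)) -[leLHS]mulr1.
  by rewrite ler_wpM2l// C1.
have -> : z - a k *: iter (n k) T x = (z - rational_combination r) -
   (a k *: iter (n k) T (x - s k.+1) + a k *: iter (n k) T (s k)).
  have -> : rational_combination r = a k *: iter (n k) T (u k).
    by rewrite yk /Y rk.
  rewrite -addrA -opprD; congr (_ - _).
  have {1}-> : x = 1 *: u k + (1 *: (x - s k.+1) + s k).
    by rewrite !scale1r sS [RHS]addrC -addrA [s k + _]addrC subrK.
  by rewrite !(iter_linear T) !scale1r !scalerDr.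
have := rnormD (a k *: iter (n k) T (x - s k.+1)) (a k *: iter (n k) T (s k)).
set v := _ + a k *: _ => hv.
have vN : rnorm (- v) = rnorm v by rewrite -sub0r rnormB subr0.
by have := rnormD (z - rational_combination r) (- v); lra.
Qed.

End Construction.

(** * From weak sequential density to norm density *)

Section WeakToNorm.
Variables (R : realType) (V : normedModType R[i]).
Variables (e : int -> V) (c : V -> int -> R[i]).
Hypothesis sp : sequence_space e c.
Variables (w : int -> R[i]) (T : {linear V -> V}).
Hypothesis Tshift : bilateral_weighted_shift e w T.

Lemma scalar_group1 : scalar_group [set 1 : R[i]].
Proof.
split=> [a ->|a b -> ->|a _ a1]; [exact: oner_neq0|by rewrite /= divr1|].
apply/esym/eqP; rewrite -subr_eq0 -[_ == 0]negbK -modulus_gt0; apply/negP.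
by move=> /a1[b ->]; rewrite ltxx.
Qed.

Lemma scalar_groupU : scalar_group [set a : R[i] | a != 0].
Proof. by split=> // a b a0 b0; rewrite /= mulf_neq0// invr_eq0. Qed.

Lemma dense_rnorm (A : set V) :
  (forall z (d : R), 0 < d -> exists2 y, A y & rnorm (z - y) < d) -> dense A.
Proof.
move=> h O [z Oz] Oopen.
have /nbhs_ballP[r /= r0 rO] : nbhs z O by exact: open_nbhs_nbhs.
have rE : r = (complex.Re r)%:C by rewrite RRe_real// gtr0_real.
have [|y Ay zy] := h z (complex.Re r); first by rewrite -ltcR -rE.
exists y; split=> //; apply: rO; rewrite -ball_normE /= rE.
by rewrite rnormE ltcR.
Qed.

Lemma weak_dense_norm_dense (L : set R[i]) x : scalar_group L ->
  (forall A : set (weak_space V), seq_closed A ->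
     scalar_orbit T L x `<=` A -> A = setT) ->
  exists x, dense (scalar_orbit T L x).
Proof.
move=> Lgrp /(weak_orbit_salas sp Tshift Lgrp).
move=> /(salas_dense_orbit sp Tshift)[y yP].
by exists y; exact: dense_rnorm.
Qed.

Lemma seq_denseP (X : topologicalType) (B : set X) : seq_dense B ->
  forall A : set X, seq_closed A -> B `<=` A -> A = setT.
Proof.
move=> BT A Acl BA; rewrite -subTset -BT; exact: smallest_sub.
Qed.

Lemma weakly_seq_hypercyclic_hypercyclic :
  weakly_seq_hypercyclic T -> hypercyclic T.
Proof.
move=> [x /seq_denseP xT].
have orbitE y : orbit_of T y = scalar_orbit T [set 1] y.
  apply/seteqP; split=> z [n].
    by move=> _ <-; exists 1, n; rewrite scale1r.
  by move=> [m [-> ->]]; exists m; rewrite ?scale1r.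
have [|y yd] := @weak_dense_norm_dense [set 1] x scalar_group1.
  by move=> A Acl; rewrite -orbitE => /(xT _ Acl).
by exists y; rewrite orbitE.
Qed.

(** The projective orbit also contains 0, which is a norm limit of nonzero
multiples of any vector of the orbit, so it lies in every sequentially closed
set containing the orbit under the nonzero scalars. *)
Lemma weakly_seq_supercyclic_supercyclic :
  weakly_seq_supercyclic T -> supercyclic T.
Proof.
move=> [x /seq_denseP xT].
have [|y yd] := @weak_dense_norm_dense _ x scalar_groupU.
  move=> A Acl oA; apply: xT => // _ [a [n ->]].
  have [->|a0] := eqVneq a 0; last by apply: oA; exists a, n.
  apply: (Acl (fun k => k.+1%:R^-1 *: iter n T x)) => [k|].
    by apply: oA; exists k.+1%:R^-1, n; rewrite /= invr_eq0 pnatr_eq0.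
  apply: norm_cvg_weak => d d0; pose r := rnorm (iter n T x).
  have r1 : 0 < r + 1 by rewrite ltr_wpDl// rnorm_ge0.
  have [N NP] := harmonic_lt (divr_gt0 d0 r1).
  exists N => k /NP.
  rewrite ltr_pdivlMr// scale0r subr0 rnormZ modulus_harmonic.
  by apply: le_lt_trans; rewrite ler_wpM2l// lerDl.
exists y => O O0 Oo; have [z [Oz [a [n [_ zE]]]]] := yd O O0 Oo.
by exists z; split=> //; exists a, n.
Qed.

End WeakToNorm.

(** * The spaces l_p(Z) and c_0(Z) *)

Section EllpSpace.
Variables (R : realType) (p : R) (p1 : 1 <= p).

Let p0 : 0 < p. Proof. exact: lt_le_trans p1. Qed.

Lemma ellp_psum_lt (x : ellp p1) : (psum p x < +oo)%E.
Proof. exact/p_summableP/(ellpP x). Qed.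

Lemma ellp_psum (x : ellp p1) (M : R) : 0 <= M -> rnorm x <= M ->
  forall F : {fset int}, \sum_(n <- F) modulus (x n) `^ p <= M `^ p.
Proof.
move=> M0 xM; apply/le_psumP; rewrite (psumE p1) ?ellp_psum_lt// lee_fin.
by rewrite ge0_ler_powR ?nnegrE ?pnorm_ge0 ?(ltW p0).
Qed.

Lemma rnorm_ellp_le (x : ellp p1) (M : R) : 0 <= M ->
  (forall F : {fset int}, \sum_(n <- F) modulus (x n) `^ p <= M `^ p) ->
  rnorm x <= M.
Proof. by move=> M0 xM; apply: (pnorm_le p1) => //; apply/le_psumP. Qed.

(** A finite set [F] on which the sum of the [p]-th powers is within [d ^ p] of
the total leaves less than [d ^ p] for any finite set outside [F]. *)
Lemma ellp_finite_approx (x : ellp p1) (d : R) : 0 < d ->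
  exists s, rnorm (x - combination (ellp_delta p1) s) <= d.
Proof.
move=> d0; have dp : 0 < d `^ p by rewrite powR_gt0.
have [F FP] : exists F : {fset int},
    pnorm p x `^ p - d `^ p < \sum_(n <- F) modulus (x n) `^ p.
  apply: contrapT => h.
  have : (psum p x <= (pnorm p x `^ p - d `^ p)%:E)%E.
    by apply/le_psumP => F; rewrite leNgt; apply/negP => hF; apply: h; exists F.
  by rewrite (psumE p1) ?ellp_psum_lt// lee_fin; lra.
exists [seq (n, x n) | n <- F]; apply: rnorm_ellp_le (ltW d0) _ => G.
pose H := F ++ [seq n <- G | n \notin F].
have uH : uniq H.
  rewrite cat_uniq fset_uniq filter_uniq ?fset_uniq// andbT.
  by apply/hasPn => n; rewrite mem_filter => /andP[].
have HE : \sum_(n <- [fset n in H]%fset) modulus (x n) `^ p =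
    \sum_(n <- F) modulus (x n) `^ p +
    \sum_(n <- G | n \notin F) modulus (x n) `^ p.
  rewrite -[X in _ + X]big_filter -big_cat; apply: perm_big.
  by apply: uniq_perm => [|//|n]; rewrite ?fset_uniq// in_fset.
have : \sum_(n <- [fset n in H]%fset) modulus (x n) `^ p <= pnorm p x `^ p.
  by apply: ellp_psum => //; rewrite pnorm_ge0.
rewrite HE => hH.
suff -> : \sum_(n <- G) modulus ((x - combination (ellp_delta p1)
     [seq (n, x n) | n <- F] : ellp p1) n) `^ p =
   \sum_(n <- G | n \notin F) modulus (x n) `^ p by lra.
rewrite [RHS]big_mkcond; apply: eq_bigr => n _.
rewrite (@entry_restriction R _ (ellp_delta p1) (@ellp_val R p p1))
  ?fset_uniq//.
by case: ifP => nF; rewrite ?nF ?modulus0 ?powR0 ?gt_eqF.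
Qed.

(** On a finite set of indices the pointwise limit agrees with some [u l], so
the bound for [u l - u k] passes to the limit without any exchange of limit and
sum. *)
Lemma ellp_stationary_limit (u : nat -> ellp p1) (b : nat -> R) :
  (forall k l, (k <= l)%N -> rnorm (u l - u k) <= b k) ->
  (forall n, exists k, forall l, (k <= l)%N -> u l n = u k n) ->
  exists x : ellp p1, forall k, rnorm (x - u k) <= b k.
Proof.
move=> ub /choice[K KP]; pose x n := u (K n) n.
have b0 k : 0 <= b k by apply: le_trans (ub k k (leqnn k)); exact: rnorm_ge0.
have xu k : (psum p (x - u k)%R <= (b k `^ p)%:E)%E.
  apply/le_psumP => F; pose l := maxn k (\max_(n <- F) K n).
  apply: le_trans (ellp_psum (b0 k) (ub k l (leq_maxl _ _)) F).
  rewrite big_seq [leRHS]big_seq; apply: ler_sum => n nF.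
  rewrite -[modulus _ `^ p in leLHS]/(modulus (x n - u k n) `^ p).
  have -> : x n = u l n.
    rewrite /x KP//; apply: leq_trans (leq_maxr _ _).
    exact: (leq_bigmax_seq (F := K)).
  exact: lexx.
have xp : x \in p_summable p1.
  apply/p_summableP; rewrite -[x](subrK (u 0%N : int -> R[i])).
  by apply: (psumD p1 _ (ellp_psum_lt _)).1; exact: le_lt_trans (xu _) (ltry _).
exists (Ellp xp) => k; apply: rnorm_ellp_le => //.
exact/le_psumP/xu.
Qed.

Lemma ellp_sequence_space : sequence_space (ellp_delta p1) (@ellp_val R p p1).
Proof.
split=> //.
- by move=> x x0; apply/val_inj/funext.
- by move=> x n; apply: (modulus_le_pnorm p1); exact: ellp_psum_lt.
- move=> n; apply: rnorm_ellp_le => // F; rewrite powR1.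
  rewrite (eq_bigr (fun m => if m == n then 1 else 0)) => [|m _]; last first.
    rewrite /= /seq_delta; case: eqP; rewrite ?modulus1 ?powR1//.
    by rewrite modulus0 powR0 ?gt_eqF.
  have [nF|nF] := boolP (n \in F).
    by rewrite (bigD1_seq n) ?fset_uniq//= eqxx big1 ?addr0// => m /negPf ->.
  rewrite big_seq big1// => m mF; case: eqP => // mn.
  by move: nF; rewrite -mn mF.
- exact: ellp_finite_approx.
by move=> u b _; exact: ellp_stationary_limit.
Qed.

End EllpSpace.

Section C0Space.
Variable R : realType.

Lemma c0_finite_approx (x : c0 R) (d : R) : 0 < d ->
  exists s, rnorm (x - combination (@c0_delta R) s) <= d.
Proof.
move=> d0; have /asboolP/(_ d d0)[N xN] := c0P x.
pose s := undup ([seq n%:Z | n <- iota 0 N] ++ [seq - n%:Z | n <- iota 0 N]).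
have sP (n : int) : (`|n| < N)%N -> n \in s.
  move=> nN; rewrite mem_undup mem_cat; apply/orP.
  have nI : `|n|%N \in iota 0 N by rewrite mem_iota.
  have [nE|nE] : n = `|n|%N%:Z \/ n = - `|n|%N%:Z by lia.
    by left; rewrite nE; apply: map_f.
  by right; rewrite nE; apply: (map_f (fun n => - n%:Z)).
exists [seq (n, x n) | n <- s]; apply: supnorm_le => n.
rewrite (@entry_restriction R _ (@c0_delta R) (@c0_val R)) ?undup_uniq//.
case: ifP => [_|ns]; first by rewrite modulus0 ltW.
apply/ltW/xN; rewrite leqNgt; apply/negP => /sP.
by rewrite ns.
Qed.

Lemma c0_stationary_limit (u : nat -> c0 R) (b : nat -> R) :
  (forall d : R, 0 < d -> exists k, b k < d) ->
  (forall k l, (k <= l)%N -> rnorm (u l - u k) <= b k) ->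
  (forall n, exists k, forall l, (k <= l)%N -> u l n = u k n) ->
  exists x : c0 R, forall k, rnorm (x - u k) <= b k.
Proof.
move=> b0 ub /choice[K KP]; pose x n := u (K n) n.
have xu k n : modulus (x n - u k n) <= b k.
  apply: le_trans (ub k (maxn k (K n)) (leq_maxl _ _)).
  rewrite /x -(KP n (maxn k (K n))) ?leq_maxr//.
  exact: (modulus_le_supnorm n (c0P (u (maxn k (K n)) - u k))).
have xv : x \in @vanishing R.
  apply/asboolP => d d0; have d2 : 0 < d / 2 by rewrite divr_gt0.
  have [k bk] := b0 _ d2; have /asboolP/(_ _ d2)[N uN] := c0P (u k).
  exists N => n /uN un; have := le_modulus_sub (x n) (u k n).
  by have := xu k n; lra.
exists (C0 xv) => k; apply: supnorm_le => n; exact: xu.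
Qed.

Lemma c0_sequence_space : sequence_space (@c0_delta R) (@c0_val R).
Proof.
split=> //.
- by move=> x x0; apply/val_inj/funext.
- by move=> x n; apply: modulus_le_supnorm; exact: c0P.
- move=> n; apply: supnorm_le => m; rewrite /= /seq_delta.
  by case: eqP; rewrite ?modulus1 ?modulus0.
- exact: c0_finite_approx.
exact: c0_stationary_limit.
Qed.

End C0Space.

Theorem proposition1p4 (R : realType) :
  (forall (p : R) (p1 : 1 <= p) (w : int -> R[i])
      (T : {linear ellp p1 -> ellp p1}),
    bilateral_weighted_shift (ellp_delta p1) w T ->
    (weakly_seq_hypercyclic T -> hypercyclic T) /\
    (weakly_seq_supercyclic T -> supercyclic T)) /\
  (forall (w : int -> R[i]) (T : {linear c0 R -> c0 R}),
    bilateral_weighted_shift (@c0_delta R) w T ->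
    (weakly_seq_hypercyclic T -> hypercyclic T) /\
    (weakly_seq_supercyclic T -> supercyclic T)).
Proof.
split=> [p p1 w T Tshift|w T Tshift].
  have sp := ellp_sequence_space p1; split.
    exact (weakly_seq_hypercyclic_hypercyclic sp Tshift).
  exact (weakly_seq_supercyclic_supercyclic sp Tshift).
have sp := c0_sequence_space R; split.
  exact (weakly_seq_hypercyclic_hypercyclic sp Tshift).
exact (weakly_seq_supercyclic_supercyclic sp Tshift).
Qed.
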